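(* Let $H=(h_{i\bar j})$, $h_{i\bar j}=\partial_i\bar\partial_j\Phi$, be a Kähler metric on $\mathbb{C}^n$ with potential $\Phi$, and let $\bullet$ be the non-normalized star product on $C^\infty(\mathbb{C}^n)[[\hbar]]$ (defined in the context by a formal Gaussian integral). Then for all $f_1,f_2\in C^\infty(\mathbb{C}^n)$, $$f_1\bullet f_2=\sum_{\Gamma\in\mathcal{G}}\frac{\hbar^{\chi(\Gamma)}}{|\mathrm{Aut}(\Gamma)|}\,D_\Gamma(f_1,f_2),$$ where $\mathcal{G}$ is the set of (isomorphism classes of) directed graphs with two special vertices $L,R$ and with solid and hollow vertices, $\chi(\Gamma)=\#\{\text{edges of }\Gamma\}-\#\{\text{solid vertices of }\Gamma\}$, and $D_\Gamma(f_1,f_2)$ is the partition function of $\Gamma$, all as defined in the context.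
   Context: **Setting.** $\partial_i=\partial/\partial z^i$, $\bar\partial_i=\partial/\partial\bar z^i$; for multi-indices $I,J\in\mathbb{Z}_{\ge0}^n$ write $\partial^I,\bar\partial^J,y^I,\bar y^J,I!,|I|$ as usual. $\Phi$ is a smooth real function on $\mathbb{C}^n$ such that $H=(h_{i\bar j})=(\partial_i\bar\partial_j\Phi)$ is positive definite everywhere. $h^{i\bar j}$ denote the entries of the inverse matrix, with the convention $\sum_j h^{i\bar j}h_{k\bar j}=\delta^i_k$. **The product $\bullet$.** It is the formal Laplace expansion at $v=z$ of $$\int_{\mathbb{C}^n} f_1(z,\bar v)f_2(v,\bar z)e^{\phi(z,\bar z;v,\bar v)/\hbar}\det H(v,\bar v)\prod_i\frac{|dv^i\wedge d\bar v^i|}{2\pi\hbar},$$ where $\phi(z,\bar z;v,\bar v)=\Phi(z,\bar v)+\Phi(v,\bar z)-\Phi(z,\bar z)-\Phi(v,\bar v)$, obtained by substituting $v=z+\epsilon y$, $\epsilon^2=\hbar$. Precisely, fix $z$ and let $E_z$ be the linear functional on polynomials in $y^1,\dots,y^n,\bar y^1,\dots,\bar y^n$ given by $E_z[y^I\bar y^J]=\partial_u^I\partial_{\bar u}^J\exp\big(\sum_{i,j}h^{i\bar j}(z)u_i\bar u_j\big)\big|_{u=\bar u=0}$ (equivalently, $\frac{\det H(z)}{\pi^n}\int_{\mathbb{C}^n} y^I\bar y^J e^{-\sum h_{i\bar j}(z)y^i\bar y^j}\,d\mathrm{Leb}(y)$). Define the formal power series in $\epsilon$ with polynomial coefficients in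 $y,\bar y$: $$F_1=\sum_J\tfrac{\epsilon^{|J|}}{J!}\bar\partial^Jf_1(z)\,\bar y^J,\qquad F_2=\sum_I\tfrac{\epsilon^{|I|}}{I!}\partial^If_2(z)\,y^I,$$ $$S=-\sum_{|I|,|J|\ge1,\,|I|+|J|\ge3}\tfrac{\epsilon^{|I|+|J|-2}}{I!J!}\partial^I\bar\partial^J\Phi(z)\,y^I\bar y^J,\qquad M=\tfrac1{\det H(z)}\sum_{I,J}\tfrac{\epsilon^{|I|+|J|}}{I!J!}\partial^I\bar\partial^J(\det H)(z)\,y^I\bar y^J.$$ Then $(f_1\bullet f_2)(z):=E_z[F_1F_2\,e^{S}M]$, with $E_z$ applied to each coefficient of $\epsilon^k$; odd powers of $\epsilon$ vanish, and one sets $\epsilon^2=\hbar$. The product is extended to $C^\infty(\mathbb{C}^n)[[\hbar]]$ by $\mathbb{C}[[\hbar]]$-bilinearity. **The graphs $\mathcal{G}$.** Finite directed graphs (multiple edges and loops allowed) with: a distinguished vertex $L$ with only outgoing edges (possibly none); a distinguished vertex $R$ with only incoming edges (possibly none); every other vertex is declared either ''solid'' or ''hollow'' (either set may be empty). A solid vertex has at least one incoming edge, at least one outgoing edge, and at least three edge-ends in total; a hollow vertex has at least one edge-end. $\mathcal{G}$ is the set of isomorphism classes of such graphs, isomorphisms preserving $L$, $R$, the vertex types and the edge directions. $\mathrm{Aut}(\Gamma)$ is the group of automorphisms (pairs of permutations of vertices and of edges compatible with sources and targets) fixing $L$ and $R$ and preserving vertex types. **Partition function.** $D_\Gamma(f_1,f_2)$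 is the function of $z$ obtained as follows. Assign to each edge $e$ two indices $k_e,l_e\in\{1,\dots,n\}$, $k_e$ at the target end and $l_e$ at the source end; the edge gets the factor $h^{k_e\bar l_e}(z)$. A vertex at which the incoming edges carry indices forming the multi-index $I$ and the outgoing edges carry indices forming the multi-index $J$ gets the factor: $-\partial^I\bar\partial^J\Phi(z)$ if solid; $\partial^I\bar\partial^J\log\det H(z)$ if hollow; $\partial^If_2(z)$ if it is $R$; $\bar\partial^Jf_1(z)$ if it is $L$. $D_\Gamma(f_1,f_2)$ is the sum over all index assignments of the product of all edge and vertex factors. *)

(* Defs.v *)
From HB Require Import structures.
(* The notations of mpoly clash with those of MathComp-Analysis. *)
From mathcomp Require Import -(notations) mpoly.
From mathcomp Require Import all_boot all_order all_algebra all_fingroup.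
From mathcomp Require Import generic_quotient.
From mathcomp Require Import all_classical all_reals all_analysis.
From mathcomp Require Import complex.
From mathcomp Require Import zify.

Set Implicit Arguments.
Unset Strict Implicit.
Unset Printing Implicit Defensive.

Import Order.TTheory GRing.Theory Num.Theory.
Import numFieldNormedType.Exports.

Local Open Scope classical_set_scope.
Local Open Scope ring_scope.
Local Open Scope complex_scope.
Local Open Scope quotient_scope.

(* The functions of [z] below are functions of the 2n real coordinates; they
   are not assumed holomorphic, and [f (z, zbar)] is written [f z]. *)
Section Calculus.
Variables (R : realType) (n : nat).
Local Notation C := R[i].
Implicit Types (f : 'rV[C]_n -> C) (z : 'rV[C]_n).

(* The real coordinate directions of C^n: [(false, j)] is d/dx^j and
   [(true, j)] is d/dy^j, where z^j = x^j + i y^j. *)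
Definition rdir (d : bool * 'I_n) : 'rV[C]_n :=
  (if d.1 then 'i%C else 1) *: delta_mx 0 d.2.

Definition rslice f z (d : bool * 'I_n) (t : R) : C := f (z + t%:C *: rdir d).

Definition rpartial (d : bool * 'I_n) f : 'rV[C]_n -> C := fun z =>
  (derive1 (fun t => complex.Re (rslice f z d t)) 0)
    +i* (derive1 (fun t => complex.Im (rslice f z d t)) 0).

Definition rpartiable (d : bool * 'I_n) f : Prop := forall z,
  derivable (fun t => complex.Re (rslice f z d t)) 0 1 /\
  derivable (fun t => complex.Im (rslice f z d t)) 0 1.

Definition continuousC f : Prop :=
  continuous (f : 'rV[(C : numFieldType)]_n -> (C : numFieldType)).

Definition smooth f : Prop := forall w : seq (bool * 'I_n),
  continuousC (foldr rpartial f w) /\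
  forall d, rpartiable d (foldr rpartial f w).

Definition dz (j : 'I_n) f : 'rV[C]_n -> C := fun z =>
  2%:R^-1 * (rpartial (false, j) f z - 'i%C * rpartial (true, j) f z).

Definition dzbar (j : 'I_n) f : 'rV[C]_n -> C := fun z =>
  2%:R^-1 * (rpartial (false, j) f z + 'i%C * rpartial (true, j) f z).

(* Multi-indices are functions ['I_n -> nat]; the type [multinom n] of
   monomial exponents coerces to it. *)
Definition dzs (I : 'I_n -> nat) f : 'rV[C]_n -> C :=
  foldr (fun i g => iter (I i) (dz i) g) f (enum 'I_n).

Definition dzbars (J : 'I_n -> nat) f : 'rV[C]_n -> C :=
  foldr (fun j g => iter (J j) (dzbar j) g) f (enum 'I_n).

Definition dmix (I J : 'I_n -> nat) f : 'rV[C]_n -> C := dzs I (dzbars J f).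

Definition mifact (I : 'I_n -> nat) : C := (\prod_(i < n) (I i)`!)%:R.

Definition cexp (x : C) : C :=
  (expR (complex.Re x) * cos (complex.Im x))
    +i* (expR (complex.Re x) * sin (complex.Im x)).

End Calculus.

Section Metric.
Variables (R : realType) (n : nat).
Local Notation C := R[i].
Variable Phi : 'rV[C]_n -> R.

Definition potential : 'rV[C]_n -> C := fun z => (Phi z)%:C.

Definition metric (z : 'rV[C]_n) : 'M[C]_n :=
  \matrix_(i, j) dz i (dzbar j potential) z.

(* In the order of [C], [0 < x] says that [x] is real and positive. *)
Definition posdef (A : 'M[C]_n) : Prop :=
  forall v : 'rV[C]_n, v != 0 ->
    0 < \sum_i \sum_j A i j * v 0 i * conjc (v 0 j).

Definition kahler_potential : Prop :=
  smooth potential /\ forall z, posdef (metric z).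

(* [hinv z i j] is h^{i \bar j}: the convention
   \sum_j h^{i \bar j} h_{k \bar j} = \delta^i_k makes (h^{i \bar j}) the
   transpose of the inverse of H. *)
Definition hinv (z : 'rV[C]_n) : 'M[C]_n := (invmx (metric z))^T.

Definition detH : 'rV[C]_n -> C := fun z => \det (metric z).

(* det H is real and positive for a positive definite H. *)
Definition logdetH : 'rV[C]_n -> C := fun z => (ln (complex.Re (detH z)))%:C.

End Metric.

Section FormalPowerSeries.
Variables (K : fieldType) (A : lalgType K).

Definition fps := nat -> A.

Definition fps_one : fps := fun k => (k == 0)%:R.

Definition fps_mul (a b : fps) : fps :=
  fun k => \sum_(i < k.+1) a i * b (k - i)%N.

Definition fps_pow (a : fps) (m : nat) : fps := iter m (fps_mul a) fps_one.

(* Only meant for [a 0 = 0], when [fps_pow a m k = 0] for [k < m]. *)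
Definition fps_exp (a : fps) : fps :=
  fun k => \sum_(m < k.+1) (m`!%:R^-1 : K) *: fps_pow a m k.

End FormalPowerSeries.

Section Star.
Variables (R : realType) (n : nat).
Local Notation C := R[i].
Local Notation mindex := (bmultinom n).
(* Polynomials in y^1, ..., y^n (variables [lshift n i]) and their conjugates
   (variables [rshift n j]). *)
Local Notation ypoly := (mpoly (n + n) C).
Variable Phi : 'rV[C]_n -> R.
Implicit Types (f : 'rV[C]_n -> C) (z : 'rV[C]_n).

Definition ymon (I J : 'I_n -> nat) : ypoly :=
  (\prod_(i < n) mpolyX C (mnm1 (lshift n i)) ^+ I i) *
  (\prod_(j < n) mpolyX C (mnm1 (rshift n j)) ^+ J j).

Definition mizero : 'I_n -> nat := fun _ => 0%N.

(* [mindex b] is the finite type of the multi-indices of degree [< b]. *)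
Definition ser_F1 f z : fps ypoly := fun k =>
  \sum_(J : mindex k.+1 | mdeg J == k)
    ((mifact R J)^-1 * dzbars J f z) *: ymon mizero J.

Definition ser_F2 f z : fps ypoly := fun k =>
  \sum_(I : mindex k.+1 | mdeg I == k)
    ((mifact R I)^-1 * dzs I f z) *: ymon I mizero.

Definition ser_S z : fps ypoly := fun k =>
  - \sum_(I : mindex k.+3) \sum_(J : mindex k.+3 |
        [&& 1 <= mdeg I, 1 <= mdeg J, 3 <= mdeg I + mdeg J
          & mdeg I + mdeg J == k + 2]%N)
      ((mifact R I * mifact R J)^-1 * dmix I J (potential Phi) z) *: ymon I J.

Definition ser_M z : fps ypoly := fun k =>
  (detH Phi z)^-1 *:
    \sum_(I : mindex k.+1) \sum_(J : mindex k.+1 | (mdeg I + mdeg J == k)%N)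
      ((mifact R I * mifact R J)^-1 * dmix I J (detH Phi) z) *: ymon I J.

Definition gauss_moment z (I J : 'I_n -> nat) : C :=
  dmix I J
    (fun u => cexp (\sum_i \sum_j hinv Phi z i j * u 0 i * conjc (u 0 j))) 0.

Definition gauss_expect z (p : ypoly) : C :=
  \sum_(m <- msupp p) mcoeff m p *
    gauss_moment z (fun i => m (lshift n i)) (fun j => m (rshift n j)).

Definition star_eps f1 f2 z : nat -> C := fun k =>
  gauss_expect z
    (fps_mul (fps_mul (fps_mul (ser_F1 f1 z) (ser_F2 f2 z))
                      (fps_exp (ser_S z)))
             (ser_M z) k).

(* The coefficient of hbar^k, where hbar = epsilon^2; the odd powers of
   epsilon have coefficient 0. *)
Definition star f1 f2 (k : nat) : 'rV[C]_n -> C :=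
  fun z => star_eps f1 f2 z (2 * k).

End Star.

Inductive vertex (s t : nat) : Type :=
  LeftV | RightV | Solid of 'I_s | Hollow of 'I_t.
Arguments LeftV {s t}.
Arguments RightV {s t}.
Arguments Solid {s t}.
Arguments Hollow {s t}.

Section VertexFinite.
Variables s t : nat.

Definition vertex_code (v : vertex s t) : bool + ('I_s + 'I_t) :=
  match v with
  | LeftV => inl true | RightV => inl false
  | Solid i => inr (inl i) | Hollow i => inr (inr i)
  end.

Definition vertex_decode (c : bool + ('I_s + 'I_t)) : vertex s t :=
  match c with
  | inl b => if b then LeftV else RightV
  | inr (inl i) => Solid i | inr (inr i) => Hollow i
  end.

Lemma vertex_codeK : cancel vertex_code vertex_decode.
Proof. by case. Qed.

HB.instance Definition _ := Finite.copy (vertex s t) (can_type vertex_codeK).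

End VertexFinite.

Definition same_kind s t s' t' (v : vertex s t) (w : vertex s' t') : bool :=
  match v, w with
  | LeftV, LeftV | RightV, RightV | Solid _, Solid _ | Hollow _, Hollow _ =>
      true
  | _, _ => false
  end.

(* Every finite graph is isomorphic to one whose solid vertices, hollow
   vertices and edges are numbered. *)
Record pregraph := Pregraph {
  nsolid : nat;
  nhollow : nat;
  nedge : nat;
  src : {ffun 'I_nedge -> vertex nsolid nhollow};
  tgt : {ffun 'I_nedge -> vertex nsolid nhollow} }.

Definition pregraph_code (G : pregraph) :
    {d : nat * nat * nat & ({ffun 'I_d.2 -> vertex d.1.1 d.1.2} *
                            {ffun 'I_d.2 -> vertex d.1.1 d.1.2})%type} :=
  existT _ (nsolid G, nhollow G, nedge G) (src G, tgt G).

Definition pregraph_decode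
    (c : {d : nat * nat * nat & ({ffun 'I_d.2 -> vertex d.1.1 d.1.2} *
                            {ffun 'I_d.2 -> vertex d.1.1 d.1.2})%type}) :=
  Pregraph (projT2 c).1 (projT2 c).2.

Lemma pregraph_codeK : cancel pregraph_code pregraph_decode.
Proof. by case. Qed.

HB.instance Definition _ := Choice.copy pregraph (can_type pregraph_codeK).

Notation vertices G := (vertex (nsolid G) (nhollow G)).
Notation edges G := ('I_(nedge G)).

Definition indeg (G : pregraph) (v : vertices G) : nat :=
  #|[set e : edges G | tgt G e == v]%SET|.

Definition outdeg (G : pregraph) (v : vertices G) : nat :=
  #|[set e : edges G | src G e == v]%SET|.

Definition admissible (G : pregraph) : bool :=
  [&& indeg (LeftV : vertices G) == 0%N,
      outdeg (RightV : vertices G) == 0%N,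
      [forall i : 'I_(nsolid G),
         [&& 1 <= indeg (Solid i : vertices G),
             1 <= outdeg (Solid i : vertices G)
           & 3 <= indeg (Solid i : vertices G)
                  + outdeg (Solid i : vertices G)]%N]
    & [forall i : 'I_(nhollow G),
         (1 <= indeg (Hollow i : vertices G)
               + outdeg (Hollow i : vertices G))%N]].

Record graph := Graph { graph_val :> pregraph; _ : admissible graph_val }.

HB.instance Definition _ := [isSub for graph_val].
HB.instance Definition _ := [Choice of graph by <:].

Definition graph_compat (G G' : pregraph) (fv : vertices G -> vertices G')
    (fe : edges G -> edges G') : bool :=
  [forall v, same_kind v (fv v)] &&
  [forall e, (src G' (fe e) == fv (src G e)) && (tgt G' (fe e) == fv (tgt G e))].

Definition graph_iso (G G' : graph) : bool :=
  `[< exists (fv : vertices G -> vertices G') (fe : edges G -> edges G'),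
        [/\ bijective fv, bijective fe & graph_compat fv fe] >].

Lemma graph_iso_refl : reflexive graph_iso.
Proof.
move=> G; apply/asboolP; exists id, id; split; try by exists id.
apply/andP; split; [by apply/forallP => -[] | apply/forallP => e].
by rewrite !eqxx.
Qed.

Lemma graph_iso_symW G G' : graph_iso G G' -> graph_iso G' G.
Proof.
move=> /asboolP[fv [fe [[gv fvK gvK] [ge feK geK] /andP[/forallP kv /forallP ke]]]].
apply/asboolP; exists gv, ge; split; [by exists fv | by exists fe |].
apply/andP; split; [apply/forallP => v | apply/forallP => e].
  by have := kv (gv v); rewrite gvK; case: (gv v) => [||i|i]; case: v => [||j|j].
have /andP[/eqP hs /eqP ht] := ke (ge e).
by rewrite -(can_eq fvK) -hs geK gvK eqxx -(can_eq fvK) -ht geK gvK eqxx.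
Qed.

Lemma graph_iso_sym : symmetric graph_iso.
Proof. by move=> G G'; apply/idP/idP => /graph_iso_symW. Qed.

Lemma graph_iso_trans : transitive graph_iso.
Proof.
move=> G2 G1 G3.
move=> /asboolP[fv [fe [bfv bfe /andP[/forallP kv /forallP ke]]]].
move=> /asboolP[gv [ge [bgv bge /andP[/forallP lv /forallP le]]]].
apply/asboolP; exists (gv \o fv), (ge \o fe).
split; [exact: bij_comp | exact: bij_comp |].
apply/andP; split; [apply/forallP => v /= | apply/forallP => e /=].
  have := kv v; have := lv (fv v).
  move: (gv (fv v)) => u; move: (fv v) => w.
  by case: v w u => [||i|i] [||j|j] [||k|k].
have /andP[/eqP hs /eqP ht] := ke e.
have /andP[/eqP hs' /eqP ht'] := le (fe e).
by rewrite hs' hs ht' ht !eqxx.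
Qed.

Canonical graph_iso_equiv :=
  EquivRel graph_iso graph_iso_refl graph_iso_sym graph_iso_trans.

Definition graph_class : Type := {eq_quot graph_iso_equiv}.
HB.instance Definition _ := Choice.on graph_class.
HB.instance Definition _ := EqQuotient.on graph_class.

Definition graph_Aut (G : pregraph) : {set {perm vertices G} * {perm edges G}} :=
  [set p : {perm vertices G} * {perm edges G} | graph_compat p.1 p.2]%SET.

Definition chi (G : pregraph) : int := (nedge G)%:Z - (nsolid G)%:Z.

Section Partition.
Variables (R : realType) (n : nat).
Local Notation C := R[i].
Variables (Phi : 'rV[C]_n -> R) (G : pregraph) (f1 f2 : 'rV[C]_n -> C).

Definition in_index (k : {ffun edges G -> 'I_n}) (v : vertices G) :
    'I_n -> nat :=
  fun i => #|[set e : edges G | (tgt G e == v) && (k e == i)]%SET|.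

Definition out_index (l : {ffun edges G -> 'I_n}) (v : vertices G) :
    'I_n -> nat :=
  fun i => #|[set e : edges G | (src G e == v) && (l e == i)]%SET|.

Definition vertex_factor (k l : {ffun edges G -> 'I_n}) (v : vertices G)
    (z : 'rV[C]_n) : C :=
  match v with
  | LeftV => dzbars (out_index l v) f1 z
  | RightV => dzs (in_index k v) f2 z
  | Solid _ => - dmix (in_index k v) (out_index l v) (potential Phi) z
  | Hollow _ => dmix (in_index k v) (out_index l v) (logdetH Phi) z
  end.

Definition partition_function (z : 'rV[C]_n) : C :=
  \sum_(k : {ffun edges G -> 'I_n}) \sum_(l : {ffun edges G -> 'I_n})
    (\prod_(e : edges G) hinv Phi z (k e) (l e)) *
    (\prod_(v : vertices G) vertex_factor k l v z).

End Partition.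

Lemma sum_indeg (G : pregraph) : (\sum_(v : vertices G) indeg v = nedge G)%N.
Proof.
rewrite -[RHS]card_ord -sum1_card (partition_big (tgt G) xpredT) //=.
apply: eq_bigr => v _; rewrite /indeg -sum1_card.
by apply: eq_bigl => e; rewrite inE.
Qed.

Lemma sum_outdeg (G : pregraph) : (\sum_(v : vertices G) outdeg v = nedge G)%N.
Proof.
rewrite -[RHS]card_ord -sum1_card (partition_big (src G) xpredT) //=.
apply: eq_bigr => v _; rewrite /outdeg -sum1_card.
by apply: eq_bigl => e; rewrite inE.
Qed.

Lemma big_vertex s t (F : vertex s t -> nat) :
  (\sum_v F v = F LeftV + F RightV
                + \sum_(i < s) F (Solid i) + \sum_(i < t) F (Hollow i))%N.
Proof.
rewrite (reindex (@vertex_decode s t)) /=; last first.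
  exists (@vertex_code s t) => [|v _]; last exact: vertex_codeK.
  by case=> [[]|[]].
rewrite big_sumType /= big_sumType /= big_bool /=; lia.
Qed.

Lemma admissible_bound (G : pregraph) : admissible G ->
  (3 * nsolid G + nhollow G <= 2 * nedge G)%N /\ (nsolid G <= nedge G)%N.
Proof.
case/and4P => _ _ /forallP hs /forallP hh.
have hi := sum_indeg G; have ho := sum_outdeg G.
rewrite big_vertex in hi; rewrite big_vertex in ho.
have h3 : (nsolid G * 3 <= \sum_(i < nsolid G) indeg (Solid i : vertices G) +
                     \sum_(i < nsolid G) outdeg (Solid i : vertices G))%N.
  rewrite -big_split /= -[X in (X * _)%N]card_ord -sum_nat_const.
  by apply: leq_sum => i _; have /and3P[] := hs i.
have h1 : (nhollow G * 1 <= \sum_(i < nhollow G) indeg (Hollow i : vertices G) +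
                     \sum_(i < nhollow G) outdeg (Hollow i : vertices G))%N.
  rewrite -big_split /= -[X in (X * _)%N]card_ord -sum_nat_const.
  by apply: leq_sum => i _; apply: hh.
have h0 : (nsolid G * 1 <= \sum_(i < nsolid G) outdeg (Solid i : vertices G))%N.
  rewrite -[X in (X * _)%N]card_ord -sum_nat_const.
  by apply: leq_sum => i _; have /and3P[] := hs i.
lia.
Qed.

(* No negative power of hbar occurs in the sum over graphs. *)
Lemma chi_ge0 (G : graph) : 0 <= chi G.
Proof. by case: G => G hG; have [_] := admissible_bound hG; rewrite /chi /=; lia. Qed.

(* Each coefficient of the sum over graphs is a finite sum. *)
Lemma finite_chi (k : nat) :
  finite_set [set G : graph_class | chi (repr G) = k%:Z].
Proof.
pose B := [set P : pregraph |
  [/\ nsolid P < (2 * k).+1, nhollow P < (2 * k).+1 & nedge P < (3 * k).+1]%N].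
have inj : injective (fun G : graph_class => graph_val (repr G)).
  by move=> G G' /val_inj h; rewrite -[G]reprK -[G']reprK h.
apply: (@sub_finite_set _ _ ((fun G : graph_class => graph_val (repr G)) @^-1` B)).
  move=> G /=; case: (repr G) => P hP /=; rewrite /chi /B /= => hk.
  have [h1 h2] := admissible_bound hP.
  by split; lia.
apply: finite_preimage; first by move=> ? ? _ _; apply: inj.
have -> : B = \bigcup_(d in [set d : nat * nat * nat |
    [/\ d.1.1 < (2 * k).+1, d.1.2 < (2 * k).+1 & d.2 < (3 * k).+1]%N])
   ((fun p : {ffun 'I_d.2 -> vertex d.1.1 d.1.2} * {ffun 'I_d.2 -> vertex d.1.1 d.1.2}
     => Pregraph p.1 p.2) @` setT).
  apply/seteqP; split => [P hP|P [d hd [p _ <-]]] //.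
  by exists (nsolid P, nhollow P, nedge P) => //; exists (src P, tgt P) => //; case: P {hP}.
apply: bigcup_finite; last first.
  by move=> d _; apply: finite_image; apply: finite_finset.
apply: (@sub_finite_set _ _ ((`I_(2 * k).+1 `*` `I_(2 * k).+1) `*` `I_(3 * k).+1)).
  by case=> [[a b] c] /= [].
by do ?apply: finite_setX; apply: finite_II.
Qed.

(* Main.v *)
Require Import Defs.
From mathcomp Require Import -(notations) mpoly.
From mathcomp Require Import all_boot all_order all_algebra all_fingroup.
From mathcomp Require Import generic_quotient.
From mathcomp Require Import all_classical all_reals all_analysis.
From mathcomp Require Import complex finmap.
From mathcomp Require Import zify ring.

(* Expanding every Taylor series, f1 * f2 becomes a sum over s solid and t
   hollow vertices, each carrying a pair of multi-indices (I_v, J_v), of the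
   product of the vertex factors divided by I_v! J_v!, times one Gaussian moment
   E[y^(sum I_v) ybar^(sum J_v)].  The hollow vertices come from det H =
   exp (log det H).  On the graph side, orbit counting replaces the sum over
   isomorphism classes weighted by 1/|Aut| by the sum over numbered graphs
   divided by s! t! e!; grouping the numbered graphs and index assignments by
   the multi-indices seen at each vertex, Wick's theorem turns the sum of the
   products of edge factors into e! E[...] / prod_v (I_v! J_v!). *)

Set Implicit Arguments.
Unset Strict Implicit.
Unset Printing Implicit Defensive.
Import Order.TTheory GRing.Theory Num.Theory.
Import numFieldNormedType.Exports.
Local Open Scope classical_set_scope.
Local Open Scope ring_scope.
Local Open Scope complex_scope.
Local Open Scope quotient_scope.

(** * Partial derivatives *)

Section Calc.
Variables (R : realType) (n : nat).
Local Notation C := R[i].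
Implicit Types (f g : 'rV[C]_n -> C) (z : 'rV[C]_n) (d : bool * 'I_n).

(** The two sides agree in the power of hbar by a count of half-edges. A vertex with multi-indices
    I, J carries epsilon^(|I| + |J|), lowered by 2 when it is solid because Phi is divided by hbar
    in the exponent. A Gaussian moment vanishes unless the I and the J have the same total degree e,
    which is the number of edges, so the power of epsilon is 2 e - 2 s, that is 2 chi. At order
    hbar^k this forces e = s + k, and 3 s + t <= 2 e then gives s + t <= 2 k: all sums are finite,
    and polynomials truncated at one common degree suffice. Iterated derivatives are treated as
    words of directions, so that Leibniz rules become inductions on lists. The exponential formula
    for det H is not proved by expanding iterated derivatives of an exponential, as in the formula
    of Faa di Bruno, but from the first-order equation d(det H) = d(log det H) det H, which formal
    series and functions both satisfy. Edges are numbered along with the vertices: sources, targets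
    and indices are then plain words of length e, and all multiplicities are multinomial counts of
    words. *)

Definition is_rpartial d f z (v : C) : Prop :=
  is_derive (0 : R) (1 : R) (fun t => complex.Re (rslice f z d t)) (complex.Re v) /\
  is_derive (0 : R) (1 : R) (fun t => complex.Im (rslice f z d t)) (complex.Im v).

Lemma is_rpartialE d f z v : is_rpartial d f z v -> rpartial d f z = v.
Proof.
case=> h1 h2; rewrite /rpartial !derive1E.
by rewrite (@derive_val _ _ _ _ _ _ _ h1) (@derive_val _ _ _ _ _ _ _ h2); case: v {h1 h2}.
Qed.

Lemma rpartiableP d f : rpartiable d f -> forall z, is_rpartial d f z (rpartial d f z).
Proof.
move=> h z; have [h1 h2] := h z.
by split; rewrite /= derive1E; apply: DeriveDef.
Qed.

Lemma is_rpartialW d f f' : (forall z, is_rpartial d f z (f' z)) ->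
  rpartiable d f /\ rpartial d f = f'.
Proof.
move=> h; split; first by move=> z; case: (h z) => h1 h2; split; apply: ex_derive.
by apply: funext => z; apply: is_rpartialE.
Qed.

Lemma is_derive_congr (x v : R) (p q : R -> R) a b :
  is_derive x v p a -> p = q -> a = b -> is_derive x v q b.
Proof. by move=> h <- <-. Qed.

Lemma is_rpartialM d f g z a b : is_rpartial d f z a -> is_rpartial d g z b ->
  is_rpartial d (fun z => f z * g z) z (a * g z + f z * b).
Proof.
have s0 (k : 'rV[C]_n -> C) : rslice k z d 0 = k z.
  by rewrite /rslice scale0r addr0.
move=> [ar ai] [br bi]; split.
  have := is_deriveB (is_deriveM ar br) (is_deriveM ai bi).
  rewrite !s0; move=> h; apply: is_derive_congr h _ _.
        by apply: funext => t; rewrite ?fctE /rslice; case: (f _) => ? ?; case: (g _).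
  case: (f z) (g z) a b {ar ai br bi} => [? ?] [? ?] [? ?] [? ?] /=.
  by rewrite /GRing.scale /=; ring.
have := is_deriveD (is_deriveM ar bi) (is_deriveM ai br).
rewrite !s0; move=> h; apply: is_derive_congr h _ _.
  by apply: funext => t; rewrite ?fctE /rslice; case: (f _) => ? ?; case: (g _).
case: (f z) (g z) a b {ar ai br bi} => [? ?] [? ?] [? ?] [? ?] /=.
by rewrite /GRing.scale /=; ring.
Qed.

Lemma is_rpartialD d f g z a b : is_rpartial d f z a -> is_rpartial d g z b ->
  is_rpartial d (fun z => f z + g z) z (a + b).
Proof.
move=> [ar ai] [br bi]; split.
  have := is_deriveD ar br.
  move=> h; apply: is_derive_congr h _ _.
        by apply: funext => t; rewrite ?fctE /rslice; case: (f _) => ? ?; case: (g _).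
  by case: a b {ar ai br bi} => [? ?] [? ?].
have := is_deriveD ai bi.
move=> h; apply: is_derive_congr h _ _.
  by apply: funext => t; rewrite ?fctE /rslice; case: (f _) => ? ?; case: (g _).
by case: a b {ar ai br bi} => [? ?] [? ?].
Qed.

Lemma is_rpartial_cst d (a : C) z : is_rpartial d (fun=> a) z 0.
Proof. by split; rewrite /rslice /=; apply: is_derive_cst. Qed.

Lemma is_rpartial_coord d (i : 'I_n) z :
  is_rpartial d (fun z => z 0 i) z (rdir R d 0 i).
Proof.
have E t : rslice (fun z => z 0 i) z d t = z 0 i + t%:C * rdir R d 0 i.
  by rewrite /rslice !mxE.
split.
  have -> : (fun t => complex.Re (rslice (fun z => z 0 i) z d t)) =
    cst (complex.Re (z 0 i)) \+ (complex.Re (rdir R d 0 i) \*: id).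
    apply: funext => t; rewrite E; case: (z 0 i) (rdir R d 0 i) => [? ?] [? ?] /=.
    by rewrite /GRing.scale /=; ring.
  apply: is_derive_eq.
  by rewrite add0r /GRing.scale /= mulr1.
have -> : (fun t => complex.Im (rslice (fun z => z 0 i) z d t)) =
  cst (complex.Im (z 0 i)) \+ (complex.Im (rdir R d 0 i) \*: id).
  apply: funext => t; rewrite E; case: (z 0 i) (rdir R d 0 i) => [? ?] [? ?] /=.
  by rewrite /GRing.scale /=; ring.
apply: is_derive_eq.
by rewrite add0r /GRing.scale /= mulr1.
Qed.

Lemma is_rpartial_conj d f z a : is_rpartial d f z a ->
  is_rpartial d (fun z => conjc (f z)) z (conjc a).
Proof.
move=> [h1 h2]; split.
  have -> : (fun t => complex.Re (rslice (fun z => conjc (f z)) z d t)) =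
    (fun t => complex.Re (rslice f z d t)).
    by apply: funext => t; rewrite /rslice; case: (f _).
  by case: a h1 {h2}.
have -> : (fun t => complex.Im (rslice (fun z => conjc (f z)) z d t)) =
  - (fun t => complex.Im (rslice f z d t)).
  by apply: funext => t; rewrite /rslice !fctE; case: (f _).
have -> : complex.Im (conjc a) = - complex.Im a by case: a {h1 h2}.
exact: is_deriveN.
Qed.

Lemma is_rpartial_cexp d f z a : is_rpartial d f z a ->
  is_rpartial d (fun z => cexp (f z)) z (a * cexp (f z)).
Proof.
have s0 (k : 'rV[C]_n -> C) : rslice k z d 0 = k z.
  by rewrite /rslice scale0r addr0.
move=> [h1 h2].
have e1 := is_derive1_comp (is_derive_expR _) h1.
have e2 := is_derive1_comp (is_derive_cos _) h2.
have e3 := is_derive1_comp (is_derive_sin _) h2.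
split.
  have := is_deriveM e1 e2.
  move=> h; apply: is_derive_congr h _ _.
    by apply: funext => t; rewrite ?fctE /rslice /=.
  rewrite /= ?s0; case: (f z) a {h1 h2 e1 e2 e3} => [? ?] [? ?] /=.
  by rewrite /GRing.scale /=; ring.
have := is_deriveM e1 e3.
move=> h; apply: is_derive_congr h _ _.
  by apply: funext => t; rewrite ?fctE /rslice /=.
rewrite /= ?s0; case: (f z) a {h1 h2 e1 e2 e3} => [? ?] [? ?] /=.
by rewrite /GRing.scale /=; ring.
Qed.

(** The quotient a / f is written with [cexp] of minus the logarithm: smoothness of the logarithm
    then follows by induction from closure under products and [cexp], without a rule for
    inverses. *)
Lemma is_rpartial_ln d f z a : is_rpartial d f z a ->
  (forall z, 0 < f z) ->
  is_rpartial d (fun z => (ln (complex.Re (f z)))%:C) z (a * cexp (- (ln (complex.Re (f z)))%:C)).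
Proof.
have s0 (k : 'rV[C]_n -> C) : rslice k z d 0 = k z.
  by rewrite /rslice scale0r addr0.
move=> [h1 h2] fpos.
have f1 y : 0 < complex.Re (f y) /\ complex.Im (f y) = 0.
  by have := fpos y; case: (f y) => ? ? /=; rewrite ltcE /= => /andP[/eqP -> ?].
(* A positive complex number is real, so the imaginary part of the slice is constant and the
   derivative is real. *)
have ai : complex.Im a = 0.
  move: h2; have -> : (fun t => complex.Im (rslice f z d t)) = cst 0.
    by apply: funext => t; have [] := f1 (z + t%:C *: rdir R d).
  move=> h2; have := @derive_val _ _ _ _ _ _ _ h2.
  by rewrite derive_cst.
split.
  have l1 : is_derive (complex.Re (rslice f z d 0)) (1:R) (@ln R) (complex.Re (rslice f z d 0))^-1.
    by apply: is_derive1_ln; rewrite s0; have [] := f1 z.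
  have := is_derive1_comp l1 h1.
  move=> h; apply: is_derive_congr h _ _.
    by apply: funext => t; rewrite ?fctE /rslice /=.
  rewrite s0; case: a {h1 h2 l1} ai => a b /= ->.
  rewrite mul0r subr0 oppr0 cos0 mulr1 expRN lnK ?posrE; last by have [] := f1 z.
  by rewrite mulrC.
have -> : (fun t => complex.Im (rslice (fun z => (ln (complex.Re (f z)))%:C) z d t)) = cst 0.
  by apply: funext.
apply: is_derive_eq.
by case: a {h1 h2} ai => a b /= ->; rewrite oppr0 sin0 !mulr0 mul0r addr0.
Qed.
End Calc.

(** * Iterated differentiability and the rules for Wirtinger derivatives *)

Section Calc2.
Variables (R : realType) (n : nat).
Local Notation C := R[i].
Implicit Types (f g : 'rV[C]_n -> C) (z : 'rV[C]_n) (d : bool * 'I_n).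

(** The order is counted so that closure properties can be proved by induction on it: the derivative
    of a product, an exponential or a logarithm contains the original functions again, which are
    only needed to the smaller order there. *)
Fixpoint dsmooth m f : Prop :=
  if m is m'.+1 then forall d, rpartiable d f /\ dsmooth m' (rpartial d f) else True.

Definition diff_smooth f := forall m, dsmooth m f.

Lemma dsmoothS m f (f' : bool * 'I_n -> 'rV[C]_n -> C) : (forall d z, is_rpartial d f z (f' d z)) ->
  (forall d, dsmooth m (f' d)) -> dsmooth m.+1 f.
Proof. by move=> h h' d; have [r ->] := is_rpartialW (h d); split; [|exact: h']. Qed.

Lemma dsmoothW m f : dsmooth m.+1 f -> dsmooth m f.
Proof.
elim: m f => [//|m IH] f h d; have [r h'] := h d.
by split=> //; apply: IH.
Qed.

Lemma dsmoothD m f g : dsmooth m f -> dsmooth m g -> dsmooth m (fun z => f z + g z).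
Proof.
elim: m f g => [//|m IH] f g hf hg.
apply: (@dsmoothS _ _ (fun d z => rpartial d f z + rpartial d g z)).
  move=> d z; apply: is_rpartialD; apply: rpartiableP; [by case: (hf d)|by case: (hg d)].
by move=> d; apply: IH; [case: (hf d)|case: (hg d)].
Qed.

Lemma dsmoothM m f g : dsmooth m f -> dsmooth m g -> dsmooth m (fun z => f z * g z).
Proof.
elim: m f g => [//|m IH] f g hf hg.
apply: (@dsmoothS _ _ (fun d z => rpartial d f z * g z + f z * rpartial d g z)).
  move=> d z; apply: is_rpartialM; apply: rpartiableP; [by case: (hf d)|by case: (hg d)].
move=> d; apply: dsmoothD; apply: IH; do ?[exact: dsmoothW].
  by case: (hf d).
by case: (hg d).
Qed.

Lemma dsmooth_cst m (a : C) : dsmooth m (fun=> a).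
Proof.
elim: m a => [//|m IH] a.
by apply: (@dsmoothS _ _ (fun _ _ => 0)) => // d z; apply: is_rpartial_cst.
Qed.

Lemma dsmooth_cexp m f : dsmooth m f -> dsmooth m (fun z => cexp (f z)).
Proof.
elim: m f => [//|m IH] f hf.
apply: (@dsmoothS _ _ (fun d z => rpartial d f z * cexp (f z))) => d.
  by move=> z; apply: is_rpartial_cexp; apply: rpartiableP; case: (hf d).
apply: dsmoothM; first by case: (hf d).
by apply: IH; apply: dsmoothW.
Qed.

Lemma dsmooth_ln m f : (forall z, 0 < f z) -> dsmooth m f ->
  dsmooth m (fun z => (ln (complex.Re (f z)))%:C).
Proof.
move=> f0; elim: m => [//|m IH] hf.
apply: (@dsmoothS _ _ (fun d z => rpartial d f z * cexp (- (ln (complex.Re (f z)))%:C))) => d.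
  by move=> z; apply: is_rpartial_ln f0; apply: rpartiableP; case: (hf d).
apply: dsmoothM; first by case: (hf d).
apply: dsmooth_cexp.
have -> : (fun z => - (ln (complex.Re (f z)))%:C) = (fun z => -1 * (ln (complex.Re (f z)))%:C).
  by apply: funext => z; rewrite mulN1r.
by apply: dsmoothM; [apply: dsmooth_cst | apply: IH; apply: dsmoothW].
Qed.

Lemma smooth_diff_smooth f : smooth f -> diff_smooth f.
Proof.
move=> h m; have : forall w d, rpartiable d (foldr (@rpartial R n) f w).
  by move=> w; case: (h w).
elim: m f {h} => [//|m IH] f h d; split; first exact: (h [::]).
(* In [smooth] the last letter of a word is applied first, so replacing [f] by its derivative along
   [d] appends [d] at the end. *)
by apply: IH => w d'; have := h (rcons w d) d'; rewrite foldr_rcons.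
Qed.

Lemma diff_smoothM f g : diff_smooth f -> diff_smooth g -> diff_smooth (fun z => f z * g z).
Proof. by move=> hf hg m; apply: dsmoothM. Qed.
Lemma diff_smoothD f g : diff_smooth f -> diff_smooth g -> diff_smooth (fun z => f z + g z).
Proof. by move=> hf hg m; apply: dsmoothD. Qed.
Lemma diff_smooth_cst a : diff_smooth (fun=> a).
Proof. by move=> m; apply: dsmooth_cst. Qed.
Lemma diff_smooth_rpartial f d : diff_smooth f -> diff_smooth (rpartial d f).
Proof. by move=> hf m; case: (hf m.+1 d). Qed.
Lemma diff_smooth_rpartiable f d : diff_smooth f -> rpartiable d f.
Proof. by move=> hf; case: (hf 1 d). Qed.

Lemma diff_smooth_sum (I : Type) (r : seq I) (P : pred I) (F : I -> 'rV[C]_n -> C) :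
  (forall i, diff_smooth (F i)) -> diff_smooth (fun z => \sum_(i <- r | P i) F i z).
Proof.
move=> h; elim: r => [|i r IH].
  by under eq_fun do rewrite big_nil; apply: diff_smooth_cst.
under eq_fun do rewrite big_cons.
by case: (P i) => //; apply: diff_smoothD.
Qed.

Lemma diff_smooth_prod (I : Type) (r : seq I) (P : pred I) (F : I -> 'rV[C]_n -> C) :
  (forall i, diff_smooth (F i)) -> diff_smooth (fun z => \prod_(i <- r | P i) F i z).
Proof.
move=> h; elim: r => [|i r IH].
  by under eq_fun do rewrite big_nil; apply: diff_smooth_cst.
under eq_fun do rewrite big_cons.
by case: (P i) => //; apply: diff_smoothM.
Qed.

Lemma diff_smooth_coord i : diff_smooth (fun z => z 0 i).
Proof.
case=> [//|m]; apply: (@dsmoothS _ _ (fun d _ => rdir R d 0 i)) => d.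
  by move=> z; apply: is_rpartial_coord.
exact: dsmooth_cst.
Qed.

Lemma diff_smooth_conj_coord i : diff_smooth (fun z => conjc (z 0 i)).
Proof.
case=> [//|m]; apply: (@dsmoothS _ _ (fun d _ => conjc (rdir R d 0 i))) => d.
  by move=> z; apply: is_rpartial_conj; apply: is_rpartial_coord.
exact: dsmooth_cst.
Qed.

(* [inl i] stands for the holomorphic and [inr i] for the antiholomorphic
   derivative in direction [i]. *)
Definition wirt (x : 'I_n + 'I_n) f : 'rV[C]_n -> C :=
  match x with inl i => dz i f | inr i => dzbar i f end.

(** The direction and the coefficient c in 1/2 (d/dx + c d/dy), which lets each rule be proved once
    for both kinds of derivative. *)
Definition wirt_dir (x : 'I_n + 'I_n) : 'I_n * C :=
  match x with inl i => (i, - 'i%C) | inr i => (i, 'i%C) end.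

Lemma wirtE x f z : wirt x f z = 2%:R^-1 * (rpartial (false, (wirt_dir x).1) f z
  + (wirt_dir x).2 * rpartial (true, (wirt_dir x).1) f z).
Proof. by case: x => i //; rewrite /= /dz mulNr. Qed.

Lemma wirt_is x f (f' : bool * 'I_n -> C) z : (forall d, is_rpartial d f z (f' d)) ->
  wirt x f z = 2%:R^-1 * (f' (false, (wirt_dir x).1) + (wirt_dir x).2 * f' (true, (wirt_dir x).1)).
Proof. by move=> h; rewrite wirtE !(is_rpartialE (h _)). Qed.

Lemma diff_smooth_wirt x f : diff_smooth f -> diff_smooth (wirt x f).
Proof.
move=> hf; rewrite (_ : wirt x f = (fun z => 2%:R^-1 * (rpartial (false, (wirt_dir x).1) f z
  + (wirt_dir x).2 * rpartial (true, (wirt_dir x).1) f z))); last by apply: funext => z; exact: wirtE.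
apply: diff_smoothM; first exact: diff_smooth_cst.
apply: diff_smoothD; first exact: diff_smooth_rpartial.
by apply: diff_smoothM; [exact: diff_smooth_cst|exact: diff_smooth_rpartial].
Qed.

Lemma wirtM x f g : diff_smooth f -> diff_smooth g ->
  wirt x (fun z => f z * g z) = (fun z => wirt x f z * g z + f z * wirt x g z).
Proof.
move=> hf hg; apply: funext => z.
rewrite (@wirt_is x _ (fun d => rpartial d f z * g z + f z * rpartial d g z)).
  rewrite !wirtE; move: (rpartial _ f z) (rpartial _ f z) (rpartial _ g z) (rpartial _ g z).
  by move: (wirt_dir x).2 (f z) (g z) => s u v p q p' q'; ring.
by move=> d; apply: is_rpartialM; apply: rpartiableP; apply: diff_smooth_rpartiable.
Qed.

Lemma wirtD x f g : diff_smooth f -> diff_smooth g ->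
  wirt x (fun z => f z + g z) = (fun z => wirt x f z + wirt x g z).
Proof.
move=> hf hg; apply: funext => z.
rewrite (@wirt_is x _ (fun d => rpartial d f z + rpartial d g z)).
  rewrite !wirtE; move: (rpartial _ f z) (rpartial _ f z) (rpartial _ g z) (rpartial _ g z).
  by move: (wirt_dir x).2 => s p q p' q'; ring.
by move=> d; apply: is_rpartialD; apply: rpartiableP; apply: diff_smooth_rpartiable.
Qed.

Lemma wirt_cst x a : wirt x (fun=> a) = (fun=> 0).
Proof.
apply: funext => z; rewrite (@wirt_is x _ (fun d => 0)); first by rewrite mulr0 addr0 mulr0.
by move=> d; apply: is_rpartial_cst.
Qed.

Lemma wirtZ x a f : diff_smooth f -> wirt x (fun z => a * f z) = (fun z => a * wirt x f z).
Proof.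
move=> hf; rewrite wirtM ?wirt_cst //; last exact: diff_smooth_cst.
by apply: funext => z; rewrite mul0r add0r.
Qed.

Lemma wirt_sum x (I : Type) (r : seq I) (P : pred I) (F : I -> 'rV[C]_n -> C) :
  (forall i, diff_smooth (F i)) -> wirt x (fun z => \sum_(i <- r | P i) F i z) =
  (fun z => \sum_(i <- r | P i) wirt x (F i) z).
Proof.
move=> h; elim: r => [|i r IH].
  under eq_fun do rewrite big_nil; rewrite wirt_cst.
  by apply: funext => z; rewrite big_nil.
transitivity (wirt x (fun z => (if P i then F i z else 0) + \sum_(i <- r | P i) F i z)).
  by congr wirt; apply: funext => z; rewrite big_cons; case: (P i); rewrite ?add0r.
rewrite wirtD; last exact: diff_smooth_sum; last first.
  by case: (P i) => //; apply: diff_smooth_cst.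
rewrite IH; apply: funext => z; rewrite big_cons.
by case: (P i) => //; rewrite wirt_cst add0r.
Qed.

Lemma wirt_coord x i : wirt x (fun z => z 0 i) = (fun=> (x == inl i)%:R).
Proof.
have ii : 'i%C * 'i%C = -1 :> C by rewrite -expr2 sqr_i.
apply: funext => z; rewrite (@wirt_is x _ (fun d => rdir R d 0 i)); last first.
  by move=> d; apply: is_rpartial_coord.
rewrite /rdir; case: x => j /=; rewrite !mxE eqxx /=.
  have -> : (inl j == inl i :> 'I_n + 'I_n) = (i == j) by apply/eqP/eqP => [[->]|->].
  case: (i == j); last by rewrite !mulr0 addr0 mulr0.
  by rewrite !mulr1 mulNr ii opprK mulVf // pnatr_eq0.
case: (i == j); last by rewrite !mulr0 addr0 mulr0.
by rewrite !mulr1 ii subrr mulr0.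
Qed.

Lemma wirt_conj_coord x i : wirt x (fun z => conjc (z 0 i)) = (fun=> (x == inr i)%:R).
Proof.
have ii : 'i%C * 'i%C = -1 :> C by rewrite -expr2 sqr_i.
have ci : conjc ('i%C : C) = - 'i%C.
  by rewrite /= -[RHS]/((- 0) +i* (- 1))%C oppr0.
apply: funext => z; rewrite (@wirt_is x _ (fun d => conjc (rdir R d 0 i))); last first.
  by move=> d; apply: is_rpartial_conj; apply: is_rpartial_coord.
have cr b j : conjc (rdir R (b, j) 0 i) = (i == j)%:R * (if b then - 'i%C else 1) :> C.
  rewrite /rdir !mxE eqxx andTb; case: (i == j); rewrite ?mulr0 ?mul0r ?conjc0 //=.
  by rewrite mulr1 mul1r; case: b => //; rewrite conjc1.
rewrite !cr; case: x => j /=.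
  by rewrite mulr1; case: (i == j); rewrite ?mul0r ?mulr0 ?addr0 ?mulr0 // mul1r mulrNN ii subrr mulr0.
have -> : (inr j == inr i :> 'I_n + 'I_n) = (i == j) by apply/eqP/eqP => [[->]|->].
rewrite mulr1; case: (i == j); last by rewrite mul0r mulr0 addr0 mulr0.
by rewrite mul1r mulrN ii opprK mulVf // pnatr_eq0.
Qed.

Lemma wirt_cexp x f : diff_smooth f ->
  wirt x (fun z => cexp (f z)) = (fun z => wirt x f z * cexp (f z)).
Proof.
move=> hf; apply: funext => z.
rewrite (@wirt_is x _ (fun d => rpartial d f z * cexp (f z))).
  rewrite !wirtE; move: (rpartial _ f z) (rpartial _ f z) (cexp _).
  by move: (wirt_dir x).2 => s p q v; ring.
by move=> d; apply: is_rpartial_cexp; apply: rpartiableP; apply: diff_smooth_rpartiable.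
Qed.

End Calc2.
Arguments wirt {R n} x f z : simpl never.

(** * Words of derivatives *)

Section Splits.
Variable T : Type.
(* The pairs of complementary subwords of a word, as in the Leibniz rule for an
   iterated derivative. *)
Fixpoint splits (w : seq T) : seq (seq T * seq T) :=
  if w is x :: w' then
    [seq (x :: p.1, p.2) | p <- splits w'] ++ [seq (p.1, x :: p.2) | p <- splits w']
  else [:: ([::], [::])].

End Splits.

Lemma splits_sub (T : eqType) (w u v : seq T) :
  (u, v) \in splits w -> subseq u w /\ subseq v w.
Proof.
elim: w u v => [|x w IH] u v; first by rewrite inE => /eqP [-> ->].
rewrite mem_cat => /orP[] /mapP[[u' v']] /IH /= [h1 h2] [-> ->] /=.
  rewrite eqxx; split=> //; case: v' h2 => // y t h2.
  case: eqP => // _; exact: subseq_trans (subseq_cons _ _) h2.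
rewrite eqxx; split=> //; case: u' h1 => // y t h1.
case: eqP => // _; exact: subseq_trans (subseq_cons _ _) h1.
Qed.

Lemma splits_size (T : eqType) (w u v : seq T) :
  (u, v) \in splits w -> (size u + size v = size w)%N.
Proof.
elim: w u v => [|x w IH] u v; first by rewrite inE => /eqP [-> ->].
by rewrite mem_cat => /orP[] /mapP[[u' v']] /IH /= h [-> ->] /=; rewrite ?addnS -h.
Qed.

Section MWord.
Variable N : nat.
(** The multi-index as a nondecreasing word, in the order in which [dzs], [dzbars] and [mderivm]
    apply their derivatives. *)
Definition mword (m : 'I_N -> nat) : seq 'I_N :=
  flatten [seq nseq (m i) i | i <- enum 'I_N].

Lemma foldr_mword (A : Type) (D : 'I_N -> A -> A) (m : 'I_N -> nat) f :
  foldr (fun i => iter (m i) (D i)) f (enum 'I_N) = foldr D f (mword m).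
Proof.
rewrite /mword; elim: (enum _) => //= i s ->.
by rewrite foldr_cat; elim: (m i) => //= k ->.
Qed.

Definition ordle : rel 'I_N := fun i j => (i <= j)%N.

Lemma sorted_mword m : sorted ordle (mword m).
Proof.
have tr : transitive ordle by move=> a b c; apply: leq_trans.
rewrite sorted_pairwise // /mword.
have : pairwise ordle (enum 'I_N).
  rewrite -sorted_pairwise //.
  have := iota_sorted 0 N; rewrite -val_enum_ord.
  by rewrite sorted_map.
elim: (enum _) => //= i s IH /andP[h1 /IH h2].
rewrite pairwise_cat h2 andbT; apply/andP; split.
  apply/allrelP => a b /nseqP[-> _] /flattenP[? /mapP[c cs ->]] /nseqP[-> _].
  by move/allP: h1 => /(_ c cs).
elim: (m i) => //= k ->; rewrite andbT.
by apply/allP => a /nseqP[-> _]; rewrite /ordle.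
Qed.

Lemma count_mword m i : count_mem i (mword m) = m i.
Proof.
rewrite /mword count_flatten -map_comp sumnE big_map.
rewrite (bigD1_seq i) ?mem_enum ?enum_uniq //= count_nseq /= eqxx mul1n big1 ?addn0 //.
by move=> j ji; rewrite count_nseq /= (negbTE ji).
Qed.

(* A subword of a sorted word is sorted, so every factor that the Leibniz rule
   extracts from [dmix] is again of the form [dmix]: the partial derivatives
   never need to be interchanged. *)
Lemma mword_count w : sorted ordle w -> mword (fun i => count_mem i w) = w.
Proof.
move=> sw; apply: (@sorted_eq _ ordle) => //.
- by move=> a b c; apply: leq_trans.
- by move=> a b /anti_leq /val_inj.
- exact: sorted_mword.
by apply/allP => x _ /=; rewrite count_mword.
Qed.

Lemma size_mword m : size (mword m) = (\sum_i m i)%N.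
Proof.
rewrite /mword size_flatten sumnE /shape !big_map. rewrite -enumT big_enum /=.
by apply: eq_bigr => i _; rewrite size_nseq.
Qed.
End MWord.

(** * Pairs of multi-indices as words in 2n directions, and the Leibniz rule *)

Section Join.
Variables (R : realType) (n : nat).
Local Notation C := R[i].
Implicit Types (f g : 'rV[C]_n -> C) (z : 'rV[C]_n).

(** The 2n directions are numbered like the variables of the polynomials in y and its conjugate, so
    that [wderiv i] on functions corresponds to [mderiv i] on Taylor polynomials. *)
Definition wderiv (i : 'I_(n + n)) f := wirt (fintype.split i) f.

Definition mjoin (I J : 'I_n -> nat) : multinom (n + n) :=
  Multinom [tuple match fintype.split i with inl a => I a | inr b => J b end | i < n + n].

Lemma mjoinE I J i : mjoin I J i = match fintype.split i with inl a => I a | inr b => J b end.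
Proof. by rewrite /fun_of_multinom tnth_mktuple. Qed.
Lemma mjoinl I J i : mjoin I J (lshift n i) = I i.
Proof. by rewrite mjoinE -[lshift n i]/(unsplit (inl i)) unsplitK. Qed.
Lemma mjoinr I J i : mjoin I J (rshift n i) = J i.
Proof. by rewrite mjoinE -[rshift n i]/(unsplit (inr i)) unsplitK. Qed.

Lemma enum_ordD : enum 'I_(n + n) = map (lshift n) (enum 'I_n) ++ map (@rshift n n) (enum 'I_n).
Proof.
apply: (inj_map val_inj); rewrite val_enum_ord map_cat iotaD add0n -{2}[n]addn0 iotaDl.
congr (_ ++ _); rewrite -val_enum_ord -!map_comp //.
Qed.

(** Holomorphic letters precede antiholomorphic ones in the word and [foldr] applies the last
    letters first, so the antiholomorphic derivatives act first, as in [dmix]. *)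
Lemma dmixE I J f : dmix I J f = foldr wderiv f (mword (mjoin I J)).
Proof.
rewrite -foldr_mword enum_ordD foldr_cat /dmix /dzs /dzbars.
have E (s : seq 'I_n) g : foldr (fun j g => iter (J j) (dzbar j) g) g s =
   foldr (fun i => iter (mjoin I J i) (wderiv i)) g (map (@rshift n n) s).
  elim: s => //= i s ->; rewrite mjoinr; apply: eq_iter => h.
  by rewrite /wderiv -[rshift n i]/(unsplit (inr i)) unsplitK.
rewrite E; move: (foldr _ f _) => g; elim: (enum 'I_n) => //= i s ->; rewrite mjoinl; apply: eq_iter => h.
by rewrite /wderiv -[lshift n i]/(unsplit (inl i)) unsplitK.
Qed.

Lemma ymonE I J : ymon R I J = mpolyX C (mjoin I J).
Proof.
rewrite mpolyXE_id big_split_ord /= /ymon; congr (_ * _); apply: eq_bigr => i _.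
  by rewrite mjoinl.
by rewrite mjoinr.
Qed.

Lemma diff_smooth_wirts (T : Type) (e : T -> 'I_n + 'I_n) w f : diff_smooth f ->
  diff_smooth (foldr (fun x => wirt (e x)) f w).
Proof. by move=> h; elim: w => //= x w IH; apply: diff_smooth_wirt. Qed.

(** The letters pass through [e] so that one rule serves both the joint words, with [fintype.split],
    and the purely holomorphic ones, with [inl]. *)
Lemma wirtsM (T : Type) (e : T -> 'I_n + 'I_n) w f g : diff_smooth f -> diff_smooth g ->
  foldr (fun x => wirt (e x)) (fun z => f z * g z) w =
  (fun z => \sum_(p <- splits w) foldr (fun x => wirt (e x)) f p.1 z *
                                 foldr (fun x => wirt (e x)) g p.2 z).
Proof.
move=> hf hg; elim: w => [|x w IH]; first by apply: funext => z; rewrite big_seq1.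
rewrite /= IH wirt_sum; last first.
  by move=> p; apply: diff_smoothM; apply: diff_smooth_wirts.
apply: funext => z; rewrite big_cat /= !big_map -big_split /=; apply: eq_bigr => p _.
by rewrite wirtM //; apply: diff_smooth_wirts.
Qed.

End Join.

(** * The determinant of the metric *)

Section Posdef.
Variables (R : realType) (n : nat).
Local Notation C := R[i].

(** The determinant is the product of the roots of the characteristic polynomial, which splits over
    C. Each root a has a row eigenvector v, and the form at v equals a times the positive number sum
    |v_j|^2, so a > 0. *)
Lemma posdef_det_gt0 (A : 'M[C]_n) : posdef A -> 0 < \det A.
Proof.
move=> pA; have [r hr] := closed_field_poly_normal (char_poly A).
rewrite (monicP (char_poly_monic A)) scale1r in hr.
have sr : size r = n.
  by have := size_char_poly A; rewrite hr size_prod_XsubC => -[].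
have h0 := char_poly_det A.
rewrite -horner_coef0 hr horner_prod in h0.
have -> : \det A = \prod_(x <- r) x.
  apply: (@mulfI _ ((-1) ^+ n)); first by rewrite signr_eq0.
  rewrite -h0 -{1}sr; elim: (r) => [|x s IH]; first by rewrite !big_nil mulr1.
  rewrite !big_cons IH hornerXsubC sub0r /= exprS; ring.
rewrite big_seq; apply: prodr_gt0 => a ar.
have : root (char_poly A) a by rewrite hr root_prod_XsubC.
rewrite -eigenvalue_root_char => /eigenvalueP[v va v0].
have := pA v v0.
have -> : \sum_i \sum_j A i j * v 0 i * conjc (v 0 j) = a * \sum_j `|v 0 j| ^+ 2.
  rewrite exchange_big mulr_sumr /=; apply: eq_bigr => j _.
  have := congr1 (fun m : 'rV_n => m 0 j) va; rewrite !mxE => e.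
  rewrite normCK -[Num.conj _]/(conjc _) mulrA -e mulr_suml.
  by apply: eq_bigr => i _; rewrite [v 0 i * _]mulrC.
rewrite pmulr_lgt0 // lt_def; apply/andP; split.
  apply: contra v0; rewrite psumr_eq0; last by move=> j _; apply: exprn_ge0.
  move/allP => h; apply/eqP/rowP => j; rewrite mxE.
  by have := h j (mem_index_enum _); rewrite sqrf_eq0 normr_eq0 => /eqP.
by apply: sumr_ge0 => j _; apply: exprn_ge0.
Qed.

Variable Phi : 'rV[C]_n -> R.
Hypothesis hPhi : kahler_potential Phi.

Lemma detH_gt0 z : 0 < detH Phi z.
Proof. by apply: posdef_det_gt0; case: hPhi. Qed.

Lemma cexp_logdetH z : cexp (logdetH Phi z) = detH Phi z.
Proof.
have := detH_gt0 z; rewrite /logdetH /cexp /=; case: (detH Phi z) => a b.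
rewrite ltcE /= => /andP[/eqP -> a0].
by rewrite sin0 cos0 mulr1 mulr0 lnK.
Qed.

Lemma diff_smooth_detH : diff_smooth (detH Phi).
Proof.
have hp i j : diff_smooth (dz i (dzbar j (potential Phi))).
  apply: (@diff_smooth_wirt _ _ (inl i)); apply: (@diff_smooth_wirt _ _ (inr j)).
  by apply: smooth_diff_smooth; case: hPhi.
rewrite /detH /determinant; apply: diff_smooth_sum => s.
apply: diff_smoothM; first exact: diff_smooth_cst.
apply: diff_smooth_prod => i.
rewrite (_ : (fun z => _) = dz i (dzbar ((s : {perm _}) i) (potential Phi))) //.
by apply: funext => z; rewrite mxE.
Qed.

Lemma diff_smooth_logdetH : diff_smooth (logdetH Phi).
Proof. by move=> m; apply: (dsmooth_ln detH_gt0); apply: diff_smooth_detH. Qed.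

(** The differential equation of det H as an exponential; [ser_M_exp] transfers it to the formal
    series. *)
Lemma wirt_detH x : wirt x (detH Phi) = (fun z => wirt x (logdetH Phi) z * detH Phi z).
Proof.
have -> : detH Phi = (fun z => cexp (logdetH Phi z)) by apply: funext => z; rewrite cexp_logdetH.
rewrite wirt_cexp //; exact: diff_smooth_logdetH.
Qed.

End Posdef.

(** * Formal power series *)

Section FpsTheory.
Variables (K : fieldType) (A : comAlgType K).
Implicit Types (a b c : fps A).

(* [p] represents the series [a] modulo degree [N]. *)
Definition fps_rep N a (p : {poly A}) := forall k, (k < N)%N -> a k = p`_k.

Lemma fps_rep_poly N a : fps_rep N a (\poly_(i < N) a i).
Proof. by move=> k kN; rewrite coef_poly kN. Qed.

Lemma fps_repM N a b p q : fps_rep N a p -> fps_rep N b q ->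
  fps_rep N (fps_mul a b) (p * q).
Proof.
move=> ha hb k kN; rewrite coefM; apply: eq_bigr => i _.
by rewrite ha ?hb // (leq_ltn_trans _ kN) // ?leq_subr // -ltnS.
Qed.

Lemma fps_rep1 N : fps_rep N (fps_one A) 1.
Proof. by move=> k _; rewrite coef1. Qed.

Lemma fps_rep_pow N a p m : fps_rep N a p -> fps_rep N (fps_pow a m) (p ^+ m).
Proof.
move=> h; elim: m => [|m IH]; first exact: fps_rep1.
by rewrite exprS; apply: fps_repM.
Qed.

Lemma fps_repZ N x a p : fps_rep N a p -> fps_rep N (fun k => x *: a k) (x%:A *: p).
Proof. by move=> h k kN; rewrite coefZ mulr_algl h. Qed.

(** Coefficient k sees both series only modulo degree k + 1, where they are polynomials;
    commutativity, like associativity below, is inherited from [{poly A}]. *)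
Lemma fps_mulC a b : fps_mul a b = fps_mul b a.
Proof.
apply: funext => k.
have ra := @fps_rep_poly k.+1 a; have rb := @fps_rep_poly k.+1 b.
by rewrite (fps_repM ra rb) // mulrC -(fps_repM rb ra).
Qed.

Lemma fps_mulA a b c : fps_mul a (fps_mul b c) = fps_mul (fps_mul a b) c.
Proof.
apply: funext => k.
have ra := @fps_rep_poly k.+1 a; have rb := @fps_rep_poly k.+1 b.
have rc := @fps_rep_poly k.+1 c.
by rewrite (fps_repM ra (fps_repM rb rc)) // mulrA -(fps_repM (fps_repM ra rb) rc).
Qed.

Lemma fps_pow_lt a m k : a 0%N = 0 -> (k < m)%N -> fps_pow a m k = 0.
Proof.
move=> a0; elim: m k => [//|m IH] k km.
rewrite /= /fps_mul big1 // => -[[|i] hi] _ /=; first by rewrite a0 mul0r.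
by rewrite -/(fps_pow a m) IH ?mulr0 //; lia.
Qed.

(** The m-th power starts in degree m, so the terms beyond k vanish and one bound N can serve all
    coefficients below N. *)
Lemma fps_expE a N k : a 0%N = 0 -> (k < N)%N ->
  fps_exp a k = \sum_(m < N) (m`!%:R^-1 : K) *: fps_pow a m k.
Proof.
move=> a0 kN; rewrite /fps_exp -!(big_mkord xpredT (fun m => (m`!%:R^-1 : K) *: fps_pow a m k)).
rewrite [RHS](@big_cat_nat _ _ _ k.+1) //= [X in _ + X]big_nat_cond [X in _ + X]big1 ?addr0 //.
by move=> m; rewrite andbT => /andP[km _]; rewrite fps_pow_lt ?scaler0.
Qed.

Lemma fps_rep_exp N a p : a 0%N = 0 -> fps_rep N a p ->
  fps_rep N (fps_exp a) (\sum_(m < N) (m`!%:R^-1 : K)%:A *: p ^+ m).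
Proof.
move=> a0 h k kN; rewrite (fps_expE a0 kN) coef_sum; apply: eq_bigr => m _.
by rewrite (fps_repZ _ (fps_rep_pow m h)).
Qed.

Section Derivation.
Hypothesis K0 : forall m, m.+1%:R != 0 :> K.
Variable d : {linear A -> A}.
Hypothesis dM : forall x y, d (x * y) = d x * y + x * d y.
Hypothesis d1 : d 1 = 0.

Lemma fps_derivM a b k : d (fps_mul a b k) = fps_mul (d \o a) b k + fps_mul a (d \o b) k.
Proof. by rewrite /fps_mul linear_sum -big_split; apply: eq_bigr => i _ /=; rewrite dM. Qed.

Lemma fps_deriv_pow a m k : d (fps_pow a m k) = fps_mul (d \o a) (fps_pow a m.-1) k *+ m.
Proof.
elim: m k => [|m IH] k.
  by rewrite mulr0n /= /fps_one; case: (k == 0%N); rewrite ?linear0 ?d1.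
rewrite /= -/(fps_pow a m) fps_derivM mulrS; congr (_ + _).
transitivity (fps_mul a (fps_mul (d \o a) (fps_pow a m.-1)) k *+ m).
  rewrite /fps_mul -sumrMnl; apply: eq_bigr => i _ /=.
  by rewrite IH /fps_mul mulrnAr.
rewrite fps_mulA [fps_mul a _]fps_mulC -fps_mulA.
by case: m {IH} => [|m]; rewrite ?mulr0n.
Qed.

(** The chain rule for a derivation acting on the coefficients, here a derivative in a y variable
    and not in epsilon: the factor m from the m-th power turns 1/m! into 1/(m-1)!. *)
Lemma fps_deriv_exp a k : a 0%N = 0 ->
  d (fps_exp a k) = fps_mul (d \o a) (fps_exp a) k.
Proof.
(* One term more than necessary: once m = 0, of derivative 0, is dropped, the k + 1 remaining terms
   are those of the exponential inside the product. *)
move=> a0; rewrite (fps_expE a0 (leqnSn k.+1)) linear_sum.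
under eq_bigr => m _ do rewrite linearZ /= fps_deriv_pow.
rewrite big_ord_recl mulr0n scaler0 add0r.
transitivity (\sum_(m < k.+1) (m`!%:R^-1 : K) *: fps_mul (d \o a) (fps_pow a m) k).
  apply: eq_bigr => m _; rewrite -scaler_nat !scalerA; congr (_ *: _).
  by rewrite /bump /= factS natrM invfM mulrAC mulVf // mul1r.
rewrite /fps_mul; under eq_bigr do rewrite scaler_sumr.
rewrite exchange_big /=; apply: eq_bigr => i _.
rewrite (@fps_expE _ k.+1) ?ltnS ?leq_subr // mulr_sumr.
by apply: eq_bigr => m _; rewrite scalerAr.
Qed.

End Derivation.
End FpsTheory.

(** * Taylor series *)

Section Taylor.
Variables (R : realType) (n : nat).
Local Notation C := R[i].
Local Notation mindex := (bmultinom n).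
Local Notation ypoly := (mpoly (n + n) C).
Implicit Types (f g : 'rV[C]_n -> C) (z : 'rV[C]_n).

Definition taylor f z : fps ypoly := fun k =>
  \sum_(I : mindex k.+1) \sum_(J : mindex k.+1 | (mdeg I + mdeg J == k)%N)
      ((mifact R I * mifact R J)^-1 * dmix I J f z) *: ymon R I J.

Lemma mifactM (I J : 'I_n -> nat) :
  mifact R I * mifact R J = (\prod_i (mjoin I J i)`!)%:R.
Proof.
rewrite /mifact -natrM big_split_ord /=; congr (_ * _)%:R.
  by apply: eq_bigr => i _; rewrite mjoinl.
by apply: eq_bigr => i _; rewrite mjoinr.
Qed.

Lemma mdeg_mjoin (I J : 'I_n -> nat) :
  mdeg (mjoin I J) = (\sum_i I i + \sum_i J i)%N.
Proof.
rewrite mdegE big_split_ord; congr (_ + _)%N.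
  by apply: eq_bigr => i _; rewrite mjoinl.
by apply: eq_bigr => i _; rewrite mjoinr.
Qed.

Lemma mjoin_split (m : multinom (n + n)) :
  mjoin (fun i => m (lshift n i)) (fun j => m (rshift n j)) = m.
Proof.
apply/mnmP => i; rewrite mjoinE -[i in RHS]splitK.
by case: (fintype.split i).
Qed.

Lemma mcoeff_taylor f z k (m : multinom (n + n)) :
  mcoeff m (taylor f z k) =
    if mdeg m == k then (\prod_i (m i)`!)%:R^-1 * foldr (@wderiv R n) f (mword m) z else 0.
Proof.
rewrite /taylor raddf_sum /=.
under eq_bigr => I _ do (rewrite raddf_sum /=; under eq_bigr => J _ do
  rewrite ymonE mcoeffZ mcoeffX mifactM dmixE).
case: eqP => [mk|/eqP mk]; last first.
  rewrite big1 // => I _; rewrite big1 // => J /eqP IJ.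
  case: eqP => [e|_]; last by rewrite mulr0.
  by move: mk; rewrite -e mdeg_mjoin -!mdegE IJ eqxx.
pose I0 : multinom n := Multinom [tuple m (lshift n i) | i < n].
pose J0 : multinom n := Multinom [tuple m (rshift n i) | i < n].
have IJ0 : mjoin I0 J0 = m.
  rewrite -[RHS]mjoin_split; apply/mnmP => i; rewrite !mjoinE.
  by case: (fintype.split i) => a; rewrite /fun_of_multinom tnth_mktuple.
have dIJ : (mdeg I0 + mdeg J0 = k)%N by have := mdeg_mjoin I0 J0; rewrite IJ0 mk -!mdegE => ->.
have hI : (mdeg I0 < k.+1)%N by lia.
have hJ : (mdeg J0 < k.+1)%N by lia.
have uniq (I J : multinom n) : mjoin I J == m -> I = I0 /\ J = J0.
  rewrite -IJ0 => /eqP e; split; apply/mnmP => i.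
    by have := congr1 (fun m : multinom _ => m (lshift n i)) e; rewrite !mjoinl.
  by have := congr1 (fun m : multinom _ => m (rshift n i)) e; rewrite !mjoinr.
rewrite (bigD1 (BMultinom hI)) //= [X in _ + X]big1 ?addr0; last first.
  move=> I neI; rewrite big1 // => J _; case: eqP => [/eqP/uniq[e _]|_]; last by rewrite mulr0.
  by move: neI; rewrite -val_eqE /= e eqxx.
rewrite (bigD1 (BMultinom hJ)) /=; last by apply/eqP.
rewrite [X in _ + X]big1 ?addr0; last first.
  move=> J /andP[_ neJ]; case: eqP => [/eqP/uniq[_ e]|_]; last by rewrite mulr0.
  by move: neJ; rewrite -val_eqE /= e eqxx.
by rewrite IJ0 eqxx mulr1.
Qed.

Lemma mcoeff0_deriv_mword (p : ypoly) (m : multinom (n + n)) :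
  mcoeff mnm0 (foldr (@mderiv _ _) p (mword m)) = mcoeff m p *+ \prod_i (m i)`!.
Proof.
rewrite -foldr_mword -[foldr _ _ _]/(mderivm m p) mcoeff_mderivm addm0.
by congr (_ *+ _); apply: eq_bigr => i _; rewrite ffactnn.
Qed.

Lemma prod_fact_neq0 N (m : 'I_N -> nat) : (\prod_i (m i)`!)%:R != 0 :> C.
Proof. by rewrite pnatr_eq0 -lt0n prodn_gt0 // => i; apply: fact_gt0. Qed.

(** A sorted word is the [mword] of its letter counts, and the factorials of the Taylor coefficient
    cancel those produced by differentiating the monomial. *)
Lemma mcoeff0_deriv_taylor f z k w : sorted (@ordle _) w ->
  mcoeff mnm0 (foldr (@mderiv _ _) (taylor f z k) w) =
    if size w == k then foldr (@wderiv R n) f w z else 0.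
Proof.
move=> sw; pose m : multinom (n + n) := Multinom [tuple count_mem i w | i < n + n].
have mE i : m i = count_mem i w by rewrite /fun_of_multinom tnth_mktuple.
have wm : mword m = w by rewrite -[RHS](mword_count sw) /mword; congr flatten; apply: eq_map => i; rewrite mE.
rewrite -{1}wm mcoeff0_deriv_mword mcoeff_taylor wm.
have -> : mdeg m = size w by rewrite mdegE -wm size_mword.
case: eqP => _; last by rewrite mul0rn.
by rewrite -[LHS]mulr_natl mulrA divff ?mul1r // prod_fact_neq0.
Qed.

(** Differentiating along [mword m] brings the coefficient of the monomial m, times an invertible
    factorial, to the constant term. *)
Lemma mpoly_deriv_eq (p q : ypoly) :
  (forall w, sorted (@ordle _) w -> mcoeff mnm0 (foldr (@mderiv _ _) p w) =
     mcoeff mnm0 (foldr (@mderiv _ _) q w)) -> p = q.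
Proof.
move=> h; apply/mpolyP => m.
have := h _ (sorted_mword m); rewrite !mcoeff0_deriv_mword -[LHS]mulr_natl -[RHS]mulr_natl.
by apply: mulfI; apply: prod_fact_neq0.
Qed.

(** Uses the same [splits] as [wirtsM], so that derivatives of formal series and of functions can be
    compared summand by summand. *)
Lemma fps_derivsM (a b : fps ypoly) w k :
  foldr (@mderiv _ _) (fps_mul a b k) w =
  \sum_(p <- splits w) fps_mul (fun k => foldr (@mderiv _ _) (a k) p.1)
                               (fun k => foldr (@mderiv _ _) (b k) p.2) k.
Proof.
elim: w k => [|x w IH] k; first by rewrite big_seq1.
rewrite /= IH linear_sum /= big_cat /= !big_map -big_split; apply: eq_bigr => p _.
rewrite /fps_mul linear_sum -big_split; apply: eq_bigr => i _ /=.
by rewrite mderivM.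
Qed.

Variable Phi : 'rV[C]_n -> R.
Hypothesis hPhi : kahler_potential Phi.

(** The constant term is dropped so that [fps_exp] applies; its exponential det H(z) is what [ser_M]
    divides by. It also matches the condition that a hollow vertex has an edge-end. *)
Definition ser_log z : fps ypoly := fun k => if k == 0%N then 0 else taylor (logdetH Phi) z k.

(* Both sides solve the same recursion on sorted words: the derivative of
   exp (log det H) along [rcons w x] is the sum over the splits (u, v) of [w] of
   the derivatives of log det H along [rcons u x] and of det H along [v], and
   formal differentiation of [fps_exp] in the y variables gives the same sum. *)
Lemma ser_M_exp z : ser_M Phi z = fps_exp (ser_log z).
Proof.
have T0 : ser_log z 0 = 0 by [].
have D0 : detH Phi z != 0 by rewrite gt_eqF // (detH_gt0 hPhi).
have K0 m : m.+1%:R != 0 :> C by rewrite pnatr_eq0.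
have expT x k : mderiv x (fps_exp (ser_log z) k) =
    fps_mul (fun j => mderiv x (ser_log z j)) (fps_exp (ser_log z)) k.
  apply: (fps_deriv_exp K0 (d := mderiv x)) => //.
    by move=> p q; exact: mderivM.
  exact: (mderivC x 1).
have main : forall w k, sorted (@ordle _) w ->
   mcoeff mnm0 (foldr (@mderiv _ _) (fps_exp (ser_log z) k) w) =
   if size w == k then (detH Phi z)^-1 * foldr (@wderiv R n) (detH Phi) w z else 0.
  (* Strong induction on the length, since the Leibniz rule leads to arbitrary subwords; the last
     letter is split off because it is applied first. *)
  move=> w; have [N] := ubnP (size w); elim: N w => // N IH w.
  case/lastP: w => [|w x] sN k sw.
    rewrite /= mulVf //.
    have pw m j : mcoeff mnm0 (fps_pow (ser_log z) m j) = ((m == 0%N) && (j == 0%N))%:R.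
      case: m => [|m]; first by rewrite /= /fps_one; case: (j == 0%N); rewrite ?raddf0 ?mcoeff1 ?eqxx.
      rewrite /= /fps_mul raddf_sum big1 // => i _.
      rewrite /= rmorphM /=.
      have -> : mcoeff mnm0 (ser_log z i) = 0.
        rewrite /ser_log; case: eqP => [_|/eqP i0]; first by rewrite raddf0.
        by rewrite mcoeff_taylor mdeg0 eq_sym (negbTE i0).
      by rewrite mul0r.
    rewrite /fps_exp raddf_sum (eq_bigr (fun m : 'I_k.+1 =>
       ((m : nat)`!%:R^-1 : C) * (((m : nat) == 0%N) && (k == 0%N))%:R)); last first.
      by move=> m _; rewrite -[LHS]/(mcoeff mnm0 (_ *: _)) mcoeffZ pw.
    rewrite big_ord_recl big1 ?addr0; last by move=> i _; rewrite mulr0.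
    by rewrite fact0 invr1 mul1r eqxx eq_sym; case: eqP.
  rewrite foldr_rcons expT fps_derivsM raddf_sum /=.
  have -> : foldr (@wderiv R n) (detH Phi) (rcons w x) z =
      \sum_(p <- splits w) foldr (@wderiv R n) (logdetH Phi) (rcons p.1 x) z *
                           foldr (@wderiv R n) (detH Phi) p.2 z.
    rewrite foldr_rcons /wderiv wirt_detH // -/(wderiv _ _).
    rewrite (wirtsM fintype.split w); last 2 first.
    - by apply: diff_smooth_wirt; apply: diff_smooth_logdetH.
    - exact: diff_smooth_detH.
    by apply: eq_bigr => p _; rewrite foldr_rcons.
  transitivity (\sum_(p <- splits w) if (size (rcons w x)) == k then
     (detH Phi z)^-1 * (foldr (@wderiv R n) (logdetH Phi) (rcons p.1 x) z *
                           foldr (@wderiv R n) (detH Phi) p.2 z) else 0); last first.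
    by case: eqP => _; rewrite ?mulr_sumr // big1.
  rewrite !big_seq; apply: eq_bigr => -[u v] /= uv.
  have [su sv] := splits_sub uv.
  have suv : (@size 'I_(n + n) u + @size 'I_(n + n) v = @size 'I_(n + n) w)%N := splits_size uv.
  have tr : transitive (@ordle (n + n)) by move=> a b c; apply: leq_trans.
  have sux : sorted (@ordle _) (rcons u x).
    by apply: subseq_sorted sw => //; rewrite -!cats1; apply: cat_subseq.
  have sv' : sorted (@ordle _) v.
    apply: subseq_sorted sw => //; apply: (subseq_trans sv); exact: subseq_rcons.
  rewrite size_rcons; rewrite size_rcons in sN.
  rewrite /fps_mul raddf_sum /=.
  (* At least the letter [x] is applied, so the constant term missing from [ser_log] makes no
     difference. *)
  have tU j : mcoeff mnm0 (foldr (@mderiv _ _) (mderiv x (ser_log z j)) u) =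
    if (size u).+1 == j then foldr (@wderiv R n) (logdetH Phi) (rcons u x) z else 0.
    rewrite -foldr_rcons /ser_log; case: j => [|j].
      have -> : foldr (@mderiv _ _) (0 : ypoly) (rcons u x) = 0.
        by elim: (rcons u x) => //= y s ->; rewrite linear0.
      by rewrite raddf0.
    by rewrite mcoeff0_deriv_taylor // size_rcons.
  have tV j : mcoeff mnm0 (foldr (@mderiv _ _) (fps_exp (ser_log z) j) v) =
    if size v == j then (detH Phi z)^-1 * foldr (@wderiv R n) (detH Phi) v z else 0.
    by apply: IH => //; lia.
  under eq_bigr => j _ do rewrite rmorphM /= tU tV.
  (* By degree only the index j = |u| + 1 of the Cauchy product can contribute, and then k - j = |v|
     exactly when k = |w| + 1. *)
  case: eqP => [wk|wk].
    have wk' : (@size 'I_(n + n) w).+1 = k := wk.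
    have uk : ((@size 'I_(n + n) u).+1 < k.+1)%N by lia.
    rewrite (bigD1 (Ordinal uk)) //= eqxx.
    have -> : @size 'I_(n + n) v == (k - (size u).+1)%N by apply/eqP; move: wk' suv; move: (size u) (size v) (size w) => a b c; lia.
    rewrite big1 ?addr0; first by rewrite mulrCA mulrA.
    move=> j; rewrite -val_eqE /= eq_sym => /negbTE ->.
    by rewrite mul0r.
  apply: big1 => j _; case: eqP => e1; last by rewrite mul0r.
  case: eqP => e2; last by rewrite mulr0.
  case: wk; have := ltn_ord j; move: e1 e2 suv.
  by move: (size u) (size v) (size w) (j : nat) => a b c d; lia.
apply: funext => k; apply: mpoly_deriv_eq => w sw.
rewrite main //.
have -> : ser_M Phi z k = (detH Phi z)^-1 *: taylor (detH Phi) z k by [].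
have -> : foldr (@mderiv _ _) ((detH Phi z)^-1 *: taylor (detH Phi) z k) w =
  (detH Phi z)^-1 *: foldr (@mderiv _ _) (taylor (detH Phi) z k) w.
  by elim: w {sw} => //= x w ->; rewrite linearZ.
rewrite mcoeffZ mcoeff0_deriv_taylor //.
by case: eqP; rewrite ?mulr0.
Qed.

End Taylor.

(** * Gaussian moments *)

Section Gauss.
Variables (R : realType) (n : nat).
Local Notation C := R[i].
Implicit Types (f g : 'rV[C]_n -> C) (z u : 'rV[C]_n).

Definition killed (x : 'I_n + 'I_n) g := diff_smooth g /\ wirt x g = (fun=> 0).

Lemma killedM x f g : killed x f -> killed x g -> killed x (fun z => f z * g z).
Proof.
move=> [hf kf] [hg kg]; split; first exact: diff_smoothM.
by rewrite wirtM // kf kg; apply: funext => z; rewrite mul0r mulr0 addr0.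
Qed.

Lemma killed_prod x (I : Type) (r : seq I) (F : I -> 'rV[C]_n -> C) :
  (forall i, killed x (F i)) -> killed x (fun z => \prod_(i <- r) F i z).
Proof.
move=> h; elim: r => [|i r IH].
  under eq_fun do rewrite big_nil.
  by split; [apply: diff_smooth_cst | rewrite wirt_cst].
under eq_fun do rewrite big_cons.
exact: killedM.
Qed.

Lemma killed_sum x (I : Type) (r : seq I) (F : I -> 'rV[C]_n -> C) :
  (forall i, killed x (F i)) -> killed x (fun z => \sum_(i <- r) F i z).
Proof.
move=> h; have hs i : diff_smooth (F i) by case: (h i).
split; first exact: diff_smooth_sum.
rewrite wirt_sum //; apply: funext => z; rewrite big1 // => i _.
by have [_ ->] := h i.
Qed.

Definition poly_fun (p : mpoly n C) u : C := meval (u 0) p.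

(** Smoothness and the formula are proved together, since the product rule for [wirt] asks for
    smooth factors. *)
Lemma wirt_poly_fun p : diff_smooth (poly_fun p) /\
  forall x, wirt x (poly_fun p) = (fun u => if x is inl i then poly_fun (mderiv i p) u else 0).
Proof.
pose P p := diff_smooth (poly_fun p) /\
  forall x, wirt x (poly_fun p) = (fun u => if x is inl i then poly_fun (mderiv i p) u else 0).
have PM q r : P q -> P r -> P (q * r).
  move=> [sq dq] [sr dr].
  have E : poly_fun (q * r) = (fun z => poly_fun q z * poly_fun r z).
    by apply: funext => z; rewrite /poly_fun mevalM.
  rewrite /P E; split=> [|x]; first exact: diff_smoothM.
  rewrite (wirtM x sq sr) dq dr; apply: funext => z.
  case: x => i; last by rewrite mul0r mulr0 addr0.
  by rewrite /poly_fun mderivM mevalD !mevalM.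
have PC c : P (mpolyC n c).
  have E : poly_fun (mpolyC n c) = (fun=> c) by apply: funext => z; rewrite /poly_fun mevalC.
  rewrite /P E; split=> [|x]; first exact: diff_smooth_cst.
  rewrite wirt_cst; apply: funext => z; case: x => // i.
  by rewrite mderivC /poly_fun meval0.
have PX i : P (mpolyX C (mnm1 i)).
  have E : poly_fun (mpolyX C (mnm1 i)) = (fun z => z 0 i).
    by apply: funext => z; rewrite /poly_fun mevalXU.
  rewrite /P E; split=> [|x]; first exact: diff_smooth_coord.
  rewrite wirt_coord; apply: funext => z; case: x => // j.
  rewrite mderivX /poly_fun mevalZ mnm1E.
  case: (eqVneq i j) => [->|ij].
    rewrite eqxx mul1r (_ : mnm_sub _ _ = mnm0) ?mevalX ?big1 //.
      by move=> k _; rewrite mnm0E.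
    by apply/mnmP => k; rewrite mnmBE mnm0E subnn.
  by rewrite mul0r; case: eqP => // -[e]; rewrite e eqxx in ij.
have PXn i k : P (mpolyX C (mnm1 i) ^+ k).
  elim: k => [|k IH]; first exact: (PC 1).
  by rewrite exprS; apply: PM.
elim/mpolyind: p => [|c m p _ _ [sp dp]]; first exact: (PC 0).
have [sm dm] : P (c *: mpolyX C m).
  rewrite -mul_mpolyC; apply: (PM); first exact: PC.
  by rewrite mpolyXE_id; apply: (big_ind P) => [|q r|i _]; [exact: (PC 1) | exact: PM | exact: PXn].
have E : poly_fun (c *: mpolyX C m + p) = (fun z => poly_fun (c *: mpolyX C m) z + poly_fun p z).
  by apply: funext => z; rewrite /poly_fun mevalD.
rewrite E; split=> [|x]; first exact: diff_smoothD.
rewrite (wirtD x sm sp) dm dp; apply: funext => z; case: x => i; last by rewrite addr0.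
by rewrite mderivD /poly_fun mevalD.
Qed.

Lemma poly_fun0 p : poly_fun p 0 = mcoeff mnm0 p.
Proof.
rewrite /poly_fun; elim/mpolyind: p => [|c m p _ _ IH]; first by rewrite meval0 raddf0.
rewrite mevalD raddfD /= IH mevalZ mcoeffZ mcoeffX mevalX; congr (_ * _ + _).
case: eqP => [->|/eqP m0]; first by rewrite big1 // => i _; rewrite mnm0E.
have [i mi] : exists i, m i != 0%N.
  apply/existsP; rewrite -negb_forall; apply: contra m0 => /forallP h.
  by apply/eqP/mnmP => i; rewrite mnm0E; apply/eqP.
by rewrite (bigD1 i) //= mxE expr0n (negbTE mi) mul0r.
Qed.

Variable h : 'M[C]_n.

(** For [h := hinv Phi z] this is, by conversion, the generating function whose derivatives at 0 are
    the values of [gauss_moment]. *)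
Definition exp_form u : C := cexp (\sum_i \sum_j h i j * u 0 i * conjc (u 0 j)).

Let Q u : C := \sum_i \sum_j h i j * u 0 i * conjc (u 0 j).
Let row_poly (j : 'I_n) : mpoly n C := \sum_i h i j *: mpolyX C (mnm1 i).
Let col_conj (i : 'I_n) u : C := \sum_j h i j * conjc (u 0 j).

Let smQ : diff_smooth Q.
Proof.
apply: diff_smooth_sum => i; apply: diff_smooth_sum => j.
apply: diff_smoothM; last exact: diff_smooth_conj_coord.
by apply: diff_smoothM; [exact: diff_smooth_cst | exact: diff_smooth_coord].
Qed.

Lemma diff_smooth_exp_form : diff_smooth exp_form.
Proof. by move=> m; apply: dsmooth_cexp; apply: smQ. Qed.

Let wirtQ x : wirt x Q = (fun u => match x with inl i => col_conj i u | inr j => poly_fun (row_poly j) u end).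
Proof.
have s1 i j : diff_smooth (fun u : 'rV[C]_n => h i j * u 0 i).
  by apply: diff_smoothM; [exact: diff_smooth_cst | exact: diff_smooth_coord].
have s2 i j : diff_smooth (fun u : 'rV[C]_n => h i j * u 0 i * conjc (u 0 j)).
  by apply: diff_smoothM => //; exact: diff_smooth_conj_coord.
rewrite /Q wirt_sum; last by move=> i; exact: diff_smooth_sum.
apply: funext => u.
have E i j : wirt x (fun u : 'rV[C]_n => h i j * u 0 i * conjc (u 0 j)) u =
  h i j * (x == inl i)%:R * conjc (u 0 j) + h i j * u 0 i * (x == inr j)%:R.
  rewrite wirtM //; last exact: diff_smooth_conj_coord.
  by rewrite wirtZ; [rewrite wirt_coord wirt_conj_coord | exact: diff_smooth_coord].
transitivity (\sum_i \sum_j (h i j * (x == inl i)%:R * conjc (u 0 j) + h i j * u 0 i * (x == inr j)%:R)).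
  by apply: eq_bigr => i _; rewrite wirt_sum //; apply: eq_bigr => j _; rewrite E.
case: x {E} => k.
  rewrite (@big_only1 _ _ _ _ k) //.
    by apply: eq_bigr => j _; rewrite eqxx mulr1 -[inl k == inr j]/false mulr0 addr0.
  move=> i ik _; apply: big1 => j _.
  by rewrite -[inl k == inl i]/(k == i) eq_sym (negbTE ik) -[inl k == inr j]/false !mulr0 mul0r addr0.
rewrite /poly_fun /row_poly raddf_sum; apply: eq_bigr => i _.
rewrite -[RHS]/(meval _ (_ *: _)) mevalZ mevalXU (@big_only1 _ _ _ _ k) //.
  by rewrite eqxx mulr1 -[inr k == inl i]/false mulr0 mul0r add0r.
move=> j jk _.
by rewrite -[inr k == inl i]/false -[inr k == inr j]/(k == j) eq_sym (negbTE jk) !mulr0 mul0r addr0.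
Qed.

Let wirt_gauss x : wirt x exp_form = (fun u =>
  match x with inl i => col_conj i u | inr j => poly_fun (row_poly j) u end * exp_form u).
Proof. by rewrite /exp_form (wirt_cexp x smQ) wirtQ. Qed.

(** The factors brought down are holomorphic, so each further antiholomorphic derivative can only
    hit the exponential. [dzs_gauss] is the conjugate situation. *)
Lemma dzbars_gauss w : foldr (fun j => wirt (inr j)) exp_form w =
  (fun u => poly_fun (\prod_(j <- w) row_poly j) u * exp_form u).
Proof.
elim: w => [|j w IH] /=.
  by apply: funext => u; rewrite big_nil /poly_fun meval1 mul1r.
have [s d] := wirt_poly_fun (\prod_(j <- w) row_poly j).
rewrite IH wirtM //; last exact: diff_smooth_exp_form.
rewrite d wirt_gauss; apply: funext => u.
by rewrite mul0r add0r mulrA big_cons /poly_fun mevalM [X in X * _]mulrC.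
Qed.

Lemma dzs_gauss w : foldr (fun j => wirt (inl j)) exp_form w =
  (fun u => \prod_(i <- w) col_conj i u * exp_form u).
Proof.
elim: w => [|i w IH] /=.
  by apply: funext => u; rewrite big_nil mul1r.
have [s d] : killed (inl i) (fun u => \prod_(i <- w) col_conj i u).
  apply: killed_prod => k; apply: killed_sum => j.
  split; last first.
    rewrite wirtZ ?wirt_conj_coord; last exact: diff_smooth_conj_coord.
    by apply: funext => u; rewrite (_ : (inl i == inr j) = false) ?mulr0 //; apply/eqP.
  by apply: diff_smoothM; [exact: diff_smooth_cst | exact: diff_smooth_conj_coord].
rewrite IH wirtM //; last exact: diff_smooth_exp_form.
rewrite d wirt_gauss; apply: funext => u.
by rewrite mul0r add0r mulrA big_cons [X in X * _]mulrC.
Qed.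

Lemma splits_nil (T : eqType) (w : seq T) (F : seq T -> C) :
  \sum_(p <- splits w) F p.1 * (p.2 == [::])%:R = F w.
Proof.
elim: w F => [|x w IH] F; first by rewrite big_seq1 eqxx mulr1.
rewrite /= big_cat !big_map /= [X in _ + X]big1 ?addr0; last by move=> p _; rewrite mulr0.
exact: (IH (fun s => F (x :: s))).
Qed.

(* The antiholomorphic derivatives produce a holomorphic polynomial factor; at 0
   the holomorphic ones must all hit it, since each one falling on the
   exponential leaves a factor linear in the conjugate of [u]. *)
Lemma dmix_gauss (I J : 'I_n -> nat) :
  dmix I J exp_form 0 = mcoeff (Multinom [tuple I i | i < n]) (\prod_j row_poly j ^+ J j)
    *+ \prod_i (I i)`!.
Proof.
pose m : multinom n := Multinom [tuple I i | i < n].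
have mE i : m i = I i by rewrite /fun_of_multinom tnth_mktuple.
rewrite /dmix /dzs /dzbars.
rewrite (foldr_mword (fun j => wirt (inr j)) J) (foldr_mword (fun j => wirt (inl j)) I).
rewrite dzbars_gauss wirtsM; first last.
- exact: diff_smooth_exp_form.
- by case: (wirt_poly_fun (\prod_(j <- mword J) row_poly j)).
transitivity (\sum_(p <- splits (mword I))
   foldr (fun x => wirt (inl x)) (poly_fun (\prod_(j <- mword J) row_poly j)) p.1 0 * (p.2 == [::])%:R).
  apply: eq_bigr => -[u v] _ /=; congr (_ * _); rewrite dzs_gauss.
  have -> : exp_form 0 = 1.
    rewrite /exp_form big1; first by rewrite /cexp /= expR0 cos0 sin0 mulr0 mulr1.
    by move=> i _; apply: big1 => j _; rewrite mxE mulr0 mul0r.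
  rewrite mulr1; case: v => [|i v]; first by rewrite big_nil.
  rewrite big_cons [X in X * _]big1 ?mul0r //.
  by move=> j _; rewrite mxE conjc0 mulr0.
rewrite (splits_nil (mword I) (fun s => foldr (fun x => wirt (inl x))
  (poly_fun (\prod_(j <- mword J) row_poly j)) s 0)).
have -> : forall w p, foldr (fun x => wirt (inl x)) (poly_fun p) w = poly_fun (foldr (@mderiv _ _) p w).
  move=> w p; elim: w => //= i w ->.
  by have [_ ->] := wirt_poly_fun (foldr (@mderiv n C) p w).
rewrite poly_fun0 -foldr_mword.
have -> : foldr (fun i => iter (I i) (@mderiv n C i)) (\prod_(j <- mword J) row_poly j) (enum 'I_n)
   = mderivm m (\prod_(j <- mword J) row_poly j).
  by rewrite /mderivm; elim: (enum _) => //= i s ->; rewrite mE.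
rewrite mcoeff_mderivm addm0; congr (mcoeff _ _ *+ _); last first.
  by apply: eq_bigr => i _; rewrite ffactnn mE.
rewrite /mword big_flatten /= big_map big_enum /=; apply: eq_bigr => j _.
by rewrite big_nseq -Monoid.iteropE.
Qed.

(** Wick's theorem with numbered edges: [l] lists the antiholomorphic indices in some order,
    expanding the product of the linear forms [row_poly (l a)] chooses a partner [k a] for each, and
    extracting the coefficient of u^I keeps the words with content I. *)
Lemma dmix_gauss_ffun (e : nat) (I J : 'I_n -> nat) (l : {ffun 'I_e -> 'I_n}) :
  (forall j, #|[set a | l a == j]%SET| = J j) ->
  dmix I J exp_form 0 = (\prod_i (I i)`!)%:R *
    \sum_(k : {ffun 'I_e -> 'I_n} | [forall i, #|[set a | k a == i]%SET| == I i])
      \prod_a h (k a) (l a).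
Proof.
move=> hJ; rewrite dmix_gauss -[LHS]mulr_natl; congr (_ * _).
have -> : \prod_j row_poly j ^+ J j = \prod_a row_poly (l a).
  rewrite (partition_big l xpredT) //=; apply: eq_bigr => j _.
  rewrite (eq_bigr (fun=> row_poly j)); last by move=> a /eqP ->.
  by rewrite prodr_const -hJ cardsE.
rewrite /row_poly bigA_distr_bigA raddf_sum [RHS]big_mkcond /=; apply: eq_bigr => k _.
have -> : \prod_a (h (k a) (l a) *: mpolyX C (mnm1 (k a))) =
   (\prod_a h (k a) (l a)) *: mpolyX C (\big[(@mnm_add n)/(@mnm0 n)]_a mnm1 (k a)).
  rewrite scaler_prod; congr (_ *: _).
  elim/big_rec2: _ => [|a m p _ ->]; [by rewrite mpolyX0 | by rewrite mpolyXD].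
rewrite mcoeffZ mcoeffX.
have -> : (\big[(@mnm_add n)/(@mnm0 n)]_a mnm1 (k a) == Multinom [tuple I i | i < n]) =
   [forall i, #|[set a | k a == i]%SET| == I i].
  apply/eqP/forallP => [e0 i|hk].
    have := congr1 (fun m : multinom n => m i) e0.
    rewrite mnm_sumE [X in _ = X]/fun_of_multinom tnth_mktuple => <-.
    by rewrite -sum1dep_card big_mkcond; apply/eqP; apply: eq_bigr => a _; rewrite mnm1E.
  apply/mnmP => i; rewrite mnm_sumE [RHS]/fun_of_multinom tnth_mktuple -(eqP (hk i)).
  by rewrite -sum1dep_card [RHS]big_mkcond; apply: eq_bigr => a _; rewrite mnm1E.
by case: ifP; rewrite ?mulr1 ?mulr0.
Qed.

End Gauss.

(** * Counting words and Wick's theorem *)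

Section Occurrences.
Implicit Types (V T : finType).

(** A sum of booleans rather than a cardinal, so that removing the first letter splits off one
    summand; [occE] and [occ2E] translate to the cardinals used for graphs. *)
Definition occ T e (k : {ffun 'I_e -> T}) (t : T) : nat := (\sum_a (k a == t))%N.

Definition occ2 V T e (v : {ffun 'I_e -> V}) (k : {ffun 'I_e -> T}) (x : V) (t : T) : nat :=
  (\sum_a ((v a == x) && (k a == t)))%N.

Definition ffun_cons T e (t : T) (k : {ffun 'I_e -> T}) : {ffun 'I_e.+1 -> T} :=
  [ffun i => oapp k t (unlift ord0 i)].

Definition ffun_behead T e (k : {ffun 'I_e.+1 -> T}) : {ffun 'I_e -> T} :=
  [ffun i => k (lift ord0 i)].

Lemma ffun_cons0 T e (t : T) (k : {ffun 'I_e -> T}) : ffun_cons t k ord0 = t.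
Proof. by rewrite ffunE unlift_none. Qed.

Lemma ffun_consS T e (t : T) (k : {ffun 'I_e -> T}) i : ffun_cons t k (lift ord0 i) = k i.
Proof. by rewrite ffunE liftK. Qed.

Lemma big_ffun_cons (S : nmodType) T e (F : {ffun 'I_e.+1 -> T} -> S) :
  \sum_k F k = \sum_t \sum_(k : {ffun 'I_e -> T}) F (ffun_cons t k).
Proof.
rewrite pair_bigA /=.
apply: (reindex (fun q : T * {ffun 'I_e -> T} => ffun_cons q.1 q.2)).
exists (fun k : {ffun 'I_e.+1 -> T} => (k ord0, ffun_behead k)) => [[t k] _|k _] /=.
  by rewrite ffun_cons0; congr (_, _); apply/ffunP => i; rewrite ffunE ffun_consS.
apply/ffunP => i; rewrite ffunE; case: unliftP => [j ->|->] //=.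
by rewrite ffunE.
Qed.

Lemma occ2_cons V T e x0 (v : {ffun 'I_e -> V}) (k : {ffun 'I_e.+1 -> T}) x t :
  occ2 (ffun_cons x0 v) k x t = ((x0 == x) && (k ord0 == t) + occ2 v (ffun_behead k) x t)%N.
Proof.
rewrite /occ2 big_ord_recl ffun_cons0; congr addn.
by apply: eq_bigr => i _; rewrite ffun_consS ffunE.
Qed.

Lemma occ_behead T e (k : {ffun 'I_e.+1 -> T}) t :
  occ k t = ((k ord0 == t) + occ (ffun_behead k) t)%N.
Proof.
by rewrite /occ big_ord_recl; congr addn; apply: eq_bigr => i _; rewrite ffunE.
Qed.

Lemma sum_occ2 V T e (v : {ffun 'I_e -> V}) (k : {ffun 'I_e -> T}) t :
  (\sum_x occ2 v k x t = occ k t)%N.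
Proof.
rewrite /occ2 exchange_big /=; apply: eq_bigr => a _.
rewrite (bigD1 (v a)) //= eqxx big1 ?addn0 // => x /negbTE.
by rewrite eq_sym => ->.
Qed.

Lemma sum_occ T e (k : {ffun 'I_e -> T}) : (\sum_t occ k t = e)%N.
Proof.
rewrite /occ exchange_big /= -[RHS]card_ord -sum1_card; apply: eq_bigr => a _.
rewrite (bigD1 (k a)) //= eqxx big1 ?addn0 // => x /negbTE.
by rewrite eq_sym => ->.
Qed.

(* The number of ways to distribute the positions of the word [k] among [V]
   so that [x] receives [c x t] letters [t]. *)
Lemma card_occ2 V T e (k : {ffun 'I_e -> T}) (c : V -> T -> nat) :
  (forall t, \sum_x c x t = occ k t)%N ->
  ((\sum_(v : {ffun 'I_e -> V}) [forall x, forall t, occ2 v k x t == c x t]) *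
    \prod_x \prod_t (c x t)`! = \prod_t (occ k t)`!)%N.
Proof.
elim: e k c => [|e IH] k c hc.
  have ok t : occ k t = 0%N by rewrite /occ big_ord0.
  have c0 x t : c x t = 0%N.
    by apply/eqP; have /eqP := hc t; rewrite ok sum_nat_eq0 => /forallP/(_ x).
  rewrite [X in (X * _)%N](eq_bigr (fun=> 1%N)); last first.
    move=> v _; have -> // : [forall x, forall t, occ2 v k x t == c x t].
    apply/forallP => x; apply/forallP => t.
    by rewrite /occ2 big_ord0 c0.
  rewrite sum_nat_const muln1 card_ffun card_ord expn0 mul1n.
  rewrite [RHS]big1; last by move=> t _; rewrite ok.
  by apply: big1 => x _; apply: big1 => t _; rewrite c0.
pose k0 := k ord0; pose k' := ffun_behead k.
(* What remains to be distributed after [x0] has received the first letter. The subtraction is exact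
   when [c x0 k0] is positive; otherwise no distribution gives that letter to [x0]. *)
pose c' x0 x t := (c x t - ((x0 == x) && (k0 == t)))%N.
rewrite big_ffun_cons big_distrl /=.
have prod_k : (\prod_t (occ k t)`! = occ k k0 * \prod_t (occ k' t)`!)%N.
  rewrite (bigD1 k0) //= [X in (_ * X)%N = _](eq_bigr (fun t => (occ k' t)`!)); last first.
    by move=> t tk; rewrite occ_behead -/k0 eq_sym (negbTE tk).
  rewrite [in RHS](bigD1 k0) //= mulnA; congr muln.
  by rewrite occ_behead -/k0 eqxx add1n factS.
(* The factor [occ k k0] is the sum of the [c x0 k0], one summand for each possible receiver of the
   first letter. *)
rewrite prod_k -hc big_distrl /=; apply: eq_bigr => x0 _.
case: (posnP (c x0 k0)) => [c0|c0].
  rewrite c0 mul0n big1 ?mul0n // => v _.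
  have -> // : [forall x, forall t, occ2 (ffun_cons x0 v) k x t == c x t] = false.
  apply/negbTE/negP => /forallP/(_ x0)/forallP/(_ k0).
  by rewrite occ2_cons -/k0 !eqxx c0.
have -> : (\prod_x \prod_t (c x t)`! = c x0 k0 * \prod_x \prod_t (c' x0 x t)`!)%N.
  rewrite !pair_bigA /= (bigD1 (x0, k0)) //= [X in (_ * X)%N = _](eq_bigr (fun p => (c' x0 p.1 p.2)`!)); last first.
    move=> [x t] /= xt; rewrite /c' (_ : (x0 == x) && _ = false) ?subn0 //.
    apply/negbTE; apply: contra xt => /andP[/eqP -> /eqP ->]; exact: eqxx.
  rewrite [in RHS](bigD1 (x0, k0)) //= mulnA; congr muln.
  by rewrite /c' !eqxx subn1 -[in LHS](prednK c0) factS prednK.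
have hc' t : (\sum_x c' x0 x t = occ k' t)%N.
  have := hc t; rewrite occ_behead -/k0 -/k' (bigD1 x0) //= [in RHS](eq_sym k0) => h.
  rewrite (bigD1 x0) //= /c' eqxx /= [X in (_ + X)%N](eq_bigr (fun x => c x t)); last first.
    by move=> x xx; rewrite eq_sym (negbTE xx) subn0.
  by move: h; case: (eqVneq t k0) => [-> |tk]; rewrite ?eqxx ?subn0 1?(eq_sym k0) ?(negbTE tk); lia.
rewrite -(IH k' (c' x0) hc') mulnCA; congr (_ * (_ * _))%N.
apply: eq_bigr => v _; congr nat_of_bool; apply: eq_forallb => x; apply: eq_forallb => t.
rewrite occ2_cons -/k0 -/k' /c'; case: andP => [[/eqP <- /eqP <-]|_]; last by rewrite subn0.
by rewrite add1n subn1 -[in LHS](prednK c0) eqSS.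
Qed.

(** A word over T distributes its positions among the elements of T, so this is [card_occ2] for the
    constant word over [unit]. *)
Lemma card_occ T e (c : T -> nat) : (\sum_t c t = e)%N ->
  ((\sum_(k : {ffun 'I_e -> T}) [forall t, occ k t == c t]) * \prod_t (c t)`! = e`!)%N.
Proof.
move=> hc; pose k0 : {ffun 'I_e -> unit} := [ffun=> tt].
have ou u : occ k0 u = e by case: u; rewrite -[RHS](sum_occ k0) (big_pred1 tt) // => -[].
have := @card_occ2 T unit e k0 (fun t _ => c t).
move=> /(_ (fun u => etrans hc (esym (ou u)))).
rewrite [RHS](big_pred1 tt) => [|[] //]; rewrite ou => <-; congr (_ * _)%N.
  apply: eq_bigr => k _; congr nat_of_bool; apply/forallP/forallP => h t.
    apply/forallP => -[]; rewrite -(eqP (h t)); apply/eqP; apply: eq_bigr => a _.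
    by rewrite ffunE andbT.
  have /forallP/(_ tt)/eqP <- := h t; apply/eqP; apply: eq_bigr => a _.
  by rewrite ffunE andbT.
by apply: eq_bigr => t _; rewrite (big_pred1 tt) => [|[]].
Qed.

End Occurrences.

(** * Wick's theorem summed over sources, targets and indices *)

Section Wick.
Variables (R : realType) (n : nat).
Local Notation C := R[i].

Lemma occE (T : finType) e (k : {ffun 'I_e -> T}) t : occ k t = #|[set a | k a == t]%SET|.
Proof. by rewrite -sum1dep_card [RHS]big_mkcond. Qed.

Lemma occ2E (V T : finType) e (v : {ffun 'I_e -> V}) (k : {ffun 'I_e -> T}) x t :
  occ2 v k x t = #|[set a | (v a == x) && (k a == t)]%SET|.
Proof. by rewrite -sum1dep_card [RHS]big_mkcond. Qed.

Definition has_occ2 (V T : finType) e (v : {ffun 'I_e -> V}) (k : {ffun 'I_e -> T})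
    (c : V -> T -> nat) : bool := [forall x, forall t, occ2 v k x t == c x t].

Definition fact2 (V T : finType) (c : V -> T -> nat) : nat := (\prod_x \prod_t (c x t)`!)%N.

Lemma fact2_neq0 (V T : finType) (c : V -> T -> nat) : (fact2 c)%:R != 0 :> C.
Proof.
rewrite pnatr_eq0 -lt0n prodn_gt0 // => x; rewrite prodn_gt0 // => t; exact: fact_gt0.
Qed.

Lemma card_has_occ2 (V T : finType) e (k : {ffun 'I_e -> T}) (c : V -> T -> nat) :
  (\sum_(v : {ffun 'I_e -> V}) has_occ2 v k c)%:R =
  (if [forall t, occ k t == \sum_x c x t]%N then (\prod_t (\sum_x c x t)%N`!)%:R / (fact2 c)%:R else 0) :> C.
Proof.
case: forallP => h.
  apply: (@mulIf _ (fact2 c)%:R); first exact: fact2_neq0.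
  rewrite divfK ?fact2_neq0 // -natrM; congr _%:R.
  have hc t : (\sum_x c x t)%N = occ k t by rewrite (eqP (h t)).
  by rewrite (card_occ2 hc); apply: eq_bigr => t _; rewrite hc.
rewrite big1 // => v _; case: (boolP (has_occ2 v k c)) => // /forallP hv.
case: h => t; rewrite -(sum_occ2 v); apply/eqP; apply: eq_bigr => x _.
by have /forallP/(_ t)/eqP := hv x.
Qed.

(** Write C and D for the total contents. For fixed words there are C!/[fact2 c] target maps and
    D!/[fact2 d] source maps. Summing over [k] absorbs C! into the moment, whichever [l] of content
    D is fixed, and there are e!/D! such words [l]. *)
Lemma wick_sum (V : finType) e (h : 'M[C]_n) (c d : V -> 'I_n -> nat) :
  \sum_(s : {ffun 'I_e -> V}) \sum_(t : {ffun 'I_e -> V})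
    \sum_(k : {ffun 'I_e -> 'I_n}) \sum_(l : {ffun 'I_e -> 'I_n})
      (has_occ2 t k c && has_occ2 s l d)%:R * \prod_a h (k a) (l a) =
  (\sum_x \sum_i d x i == e)%N%:R * (e`!)%:R / ((fact2 c)%:R * (fact2 d)%:R) *
    dmix (fun i => \sum_x c x i)%N (fun i => \sum_x d x i)%N (exp_form h) 0.
Proof.
set Cs := fun i => (\sum_x c x i)%N; set D := fun i => (\sum_x d x i)%N.
set g := dmix _ _ _ _.
transitivity (\sum_(l : {ffun 'I_e -> 'I_n}) (\sum_(s : {ffun 'I_e -> V}) has_occ2 s l d)%N%:R *
   \sum_(k : {ffun 'I_e -> 'I_n}) (\sum_(t : {ffun 'I_e -> V}) has_occ2 t k c)%N%:R * \prod_a h (k a) (l a)).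
  under eq_bigr => s _ do (rewrite exchange_big /=; under eq_bigr => k _ do rewrite exchange_big /=).
  under eq_bigr => s _ do rewrite exchange_big /=.
  rewrite exchange_big /=; apply: eq_bigr => l _.
  rewrite natr_sum mulr_suml; apply: eq_bigr => s _.
  rewrite mulr_sumr; apply: eq_bigr => k _.
  rewrite natr_sum mulr_suml mulr_sumr; apply: eq_bigr => t _.
  by case: (has_occ2 t k c); case: (has_occ2 s l d); rewrite ?mul0r ?mulr0 ?mul1r.
pose P (l : {ffun 'I_e -> 'I_n}) := [forall i, occ l i == D i].
transitivity (\sum_(l | P l) (\prod_i (D i)`!)%:R / ((fact2 c)%:R * (fact2 d)%:R) * g).
  rewrite [RHS]big_mkcond; apply: eq_bigr => l _.
  rewrite card_has_occ2 -/(P l); case: ifP => [/forallP hl|_]; last by rewrite mul0r.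
  rewrite invfM [(fact2 c)%:R^-1 * _]mulrC -!mulrA; congr (_ * (_ * _)).
  rewrite /g (@dmix_gauss_ffun _ _ _ e _ _ l); last by move=> j; rewrite -occE (eqP (hl j)).
  rewrite mulrA mulr_sumr [RHS]big_mkcond; apply: eq_bigr => k _.
  rewrite card_has_occ2 (eq_forallb (fun i => congr1 (fun m => m == Cs i) (occE k i))).
  by case: ifP => _; rewrite ?mul0r ?mulr0 // [_^-1 * _]mulrC.
transitivity ((\sum_(l : {ffun 'I_e -> 'I_n}) P l)%N%:R * (\prod_i (D i)`!)%:R
     / ((fact2 c)%:R * (fact2 d)%:R) * g).
  rewrite natr_sum !mulr_suml big_mkcond; apply: eq_bigr => l _.
  by case: (P l); rewrite ?mul1r ?mul0r.
case: eqP => hD; last first.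
  rewrite big1 ?mul0r // => l _; case: (boolP (P l)) => // /forallP h1.
  case: hD; rewrite exchange_big /= -[RHS](sum_occ l).
  by apply: eq_bigr => i _; rewrite (eqP (h1 i)).
rewrite mul1r -natrM; congr (_%:R / _ * _).
by apply: card_occ; rewrite exchange_big.
Qed.

End Wick.

(** * Expansion of the star product *)

Lemma eq_big_supp (T : eqType) (A : nmodType) (s1 s2 : seq T) (F : T -> A) :
  uniq s1 -> uniq s2 -> (forall x, F x != 0 -> (x \in s1) = (x \in s2)) ->
  \sum_(x <- s1) F x = \sum_(x <- s2) F x.
Proof.
move=> u1 u2 h.
have E s : \sum_(x <- s) F x = \sum_(x <- [seq x <- s | F x != 0]) F x.
  rewrite big_filter [RHS]big_mkcond; apply: eq_bigr => x _.
  by case: eqP => [->|].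
rewrite E [RHS]E; apply: perm_big; apply: uniq_perm; rewrite ?filter_uniq // => x.
by rewrite !mem_filter; case: (boolP (F x != 0)) => // /h ->.
Qed.

Section StarExpansion.
Variables (R : realType) (n : nat).
Local Notation C := R[i].
Local Notation mindex := (bmultinom n).
Local Notation ypoly := (mpoly (n + n) C).
Implicit Types (f g : 'rV[C]_n -> C) (z : 'rV[C]_n).

(** The coefficients of the given series sum over multi-indices with a bound depending on the
    coefficient; this moves them all to the common bound N. *)
Lemma big_mindex (A : nmodType) b N (F : multinom n -> A) :
  (forall m, F m != 0%R -> (mdeg m < b) && (mdeg m < N))%N ->
  \sum_(J : mindex b) F J = \sum_(J : mindex N) F J.
Proof.
move=> h.
have E c : \sum_(J : mindex c) F J = \sum_(m <- [seq bmnm J | J <- index_enum (mindex c)]) F m.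
  by rewrite big_map.
have M c m : (m \in [seq bmnm J | J <- index_enum (mindex c)]) = (mdeg m < c)%N.
  apply/mapP/idP => [[J _ ->]|mc]; first exact: bmdeg.
  by exists (BMultinom mc); rewrite ?mem_index_enum.
rewrite !E; apply: eq_big_supp.
- by rewrite map_inj_uniq ?index_enum_uniq //; apply: val_inj.
- by rewrite map_inj_uniq ?index_enum_uniq //; apply: val_inj.
by move=> m /h /andP[h1 h2]; rewrite !M h1 h2.
Qed.

Lemma big_mindex2 (A : nmodType) b N (P : multinom n -> multinom n -> bool)
   (F : multinom n -> multinom n -> A) :
  (forall I J, P I J -> [&& mdeg I < b, mdeg I < N, mdeg J < b & mdeg J < N])%N ->
  \sum_(I : mindex b) \sum_(J : mindex b | P I J) F I J =
  \sum_(x : mindex N * mindex N | P x.1 x.2) F x.1 x.2.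
Proof.
move=> h.
transitivity (\sum_(I : mindex N) \sum_(J : mindex N | P I J) F I J); last first.
  by rewrite pair_big_dep.
have E c I : \sum_(J : mindex c | P I J) F I J = \sum_(J : mindex c) if P I J then F I J else 0.
  exact: big_mkcond.
have H I : \sum_(J : mindex b | P I J) F I J = \sum_(J : mindex N | P I J) F I J.
  rewrite !E; apply: (big_mindex (F := fun J => if P I J then F I J else 0)) => J.
  by case: ifP => [/h /and4P[_ _ -> ->]|]; rewrite ?eqxx.
under eq_bigr do rewrite H.
apply: (big_mindex (F := fun I => \sum_(J : mindex N | P I J) F I J)) => I.
apply: contraNT => nI; apply/eqP; apply: big1 => J /h /and4P[h1 h2 _ _].
by rewrite h1 h2 in nI.
Qed.

Variable Phi : 'rV[C]_n -> R.

Lemma gauss_expectD z p q :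
  gauss_expect Phi z (p + q) = gauss_expect Phi z p + gauss_expect Phi z q.
Proof.
pose gm m := gauss_moment Phi z (fun i => m (lshift n i)) (fun j => m (rshift n j)).
pose s := undup (msupp p ++ msupp q).
have E r : {subset msupp r <= s} -> gauss_expect Phi z r = \sum_(m <- s) mcoeff m r * gm m.
  move=> rs; apply: (eq_big_supp (F := fun m => mcoeff m r * gm m)); rewrite ?undup_uniq ?msupp_uniq //.
  move=> m h; have mr : m \in msupp r.
    by rewrite -[_ \in _]negbK -mcoeff_eq0; apply: contra h => /eqP ->; rewrite mul0r.
  by rewrite mr rs.
rewrite !E; last 3 first.
- by move=> m; rewrite mem_undup mem_cat => ->; rewrite orbT.
- by move=> m; rewrite mem_undup mem_cat => ->.
- by move=> m /msuppD_le; rewrite mem_undup.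
by rewrite -big_split; apply: eq_bigr => m _; rewrite mcoeffD mulrDl.
Qed.

Lemma gauss_expectX z c (I J : 'I_n -> nat) :
  gauss_expect Phi z (c *: ymon R I J) = c * gauss_moment Phi z I J.
Proof.
case: (eqVneq c 0) => [->|c0].
  by rewrite scale0r mul0r /gauss_expect msupp0 big_nil.
rewrite /gauss_expect ymonE (msuppMCX _ c0) big_seq1 mcoeffZ mcoeffX eqxx mulr1.
by congr (_ * gauss_moment _ _ _ _); apply: funext => i; rewrite ?mjoinl ?mjoinr.
Qed.

Lemma gauss_expect_sum z (T : Type) (r : seq T) (P : pred T) (F : T -> ypoly) :
  gauss_expect Phi z (\sum_(x <- r | P x) F x) = \sum_(x <- r | P x) gauss_expect Phi z (F x).
Proof.
elim/big_rec2: _ => [|x y p _ <-]; first by rewrite /gauss_expect msupp0 big_nil.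
exact: gauss_expectD.
Qed.

Lemma ymon_prod (V : finType) (I J : V -> 'I_n -> nat) :
  \prod_v ymon R (I v) (J v) = ymon R (fun i => \sum_v I v i)%N (fun i => \sum_v J v i)%N.
Proof.
rewrite !ymonE; under eq_bigr do rewrite ymonE.
transitivity (mpolyX C (\big[(@mnm_add (n + n))/(@mnm0 (n + n))]_v mjoin (I v) (J v))).
  by elim/big_rec2: _ => [|a m p _ ->]; [rewrite mpolyX0 | rewrite mpolyXD].
congr mpolyX; apply/mnmP => i; rewrite mnm_sumE mjoinE.
under eq_bigr do rewrite mjoinE.
by case: (fintype.split i).
Qed.

Section Vertices.
Variables (f1 f2 : 'rV[C]_n -> C) (z : 'rV[C]_n).

Definition vertex_coef s t (v : vertex s t) (I J : 'I_n -> nat) : C :=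
  match v with
  | LeftV => dzbars J f1 z
  | RightV => dzs I f2 z
  | Solid _ => - dmix I J (potential Phi) z
  | Hollow _ => dmix I J (logdetH Phi) z
  end.

Definition vertex_ok s t (v : vertex s t) (a b : nat) : bool :=
  match v with
  | LeftV => a == 0%N
  | RightV => b == 0%N
  | Solid _ => [&& 1 <= a, 1 <= b & 3 <= a + b]%N
  | Hollow _ => (1 <= a + b)%N
  end.

(** The power of epsilon at a vertex; the 2 lost by a solid one is the exponent -2 in the series
    S. *)
Definition vertex_weight s t (v : vertex s t) (a b : nat) : nat :=
  match v with Solid _ => (a + b - 2)%N | _ => (a + b)%N end.

Variable N : nat.

(** One shape for all four series, so that their product is a single product over vertices and
    distributes into a sum over assignments of multi-indices. *)
Definition vertex_poly s t (v : vertex s t) : {poly ypoly} :=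
  \sum_(x : mindex N * mindex N | vertex_ok v (mdeg x.1) (mdeg x.2))
    (((mifact R x.1 * mifact R x.2)^-1 * vertex_coef v x.1 x.2) *: ymon R x.1 x.2)
     *: 'X^(vertex_weight v (mdeg x.1) (mdeg x.2)).

Lemma coef_vertex_poly s t (v : vertex s t) k :
  (vertex_poly v)`_k = \sum_(x : mindex N * mindex N |
      vertex_ok v (mdeg x.1) (mdeg x.2) && (vertex_weight v (mdeg x.1) (mdeg x.2) == k))
    ((mifact R x.1 * mifact R x.2)^-1 * vertex_coef v x.1 x.2) *: ymon R x.1 x.2.
Proof.
rewrite coef_sum big_mkcondr; apply: eq_bigr => x _.
by rewrite coefZ coefXn eq_sym; case: eqP => _; rewrite ?mulr1 ?mulr0.
Qed.

Lemma mifact0 : mifact R (@mizero n) = 1.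
Proof. by rewrite /mifact big1 // => i _. Qed.

Lemma mnm0_mizero : fun_of_multinom (@mnm0 n) = @mizero n.
Proof. by apply: funext => i; rewrite mnm0E. Qed.

Lemma ser_F1_rep K s t : (K <= N)%N -> fps_rep K (ser_F1 f1 z) (vertex_poly (@LeftV s t)).
Proof.
move=> KN k kK; rewrite coef_vertex_poly.
have m0 : (mdeg (@mnm0 n) < N)%N by rewrite mdeg0; lia.
rewrite -(pair_big_dep xpredT (fun I J : mindex N => (mdeg I == 0%N) && (mdeg I + mdeg J == k)%N)
  (fun I J => ((mifact R I * mifact R J)^-1 * dzbars J f1 z) *: ymon R I J)).
rewrite (@big_only1 _ _ _ _ (BMultinom m0)) //; last first.
  move=> I nI _; apply: big1 => J /andP[/eqP/eqP]; rewrite mdeg_eq0 => /eqP I0.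
  by case/negP: nI; apply/eqP/val_inj.
rewrite /ser_F1 /= mdeg0 eqxx mnm0_mizero mifact0 big_mkcond [RHS]big_mkcond.
transitivity (\sum_(J : mindex k.+1) if mdeg J == k then ((mifact R J)^-1 * dzbars J f1 z) *: ymon R (@mizero n) J else 0) => //.
rewrite (big_mindex (N := N) (F := fun J => if mdeg J == k then ((mifact R J)^-1 * dzbars J f1 z) *: ymon R (@mizero n) J else 0)).
  by apply: eq_bigr => J _; rewrite add0n mul1r.
by move=> J; case: (mdeg J =P k) => [->|]; rewrite ?eqxx // ltnSn (leq_trans kK KN).
Qed.

Lemma ser_F2_rep K s t : (K <= N)%N -> fps_rep K (ser_F2 f2 z) (vertex_poly (@RightV s t)).
Proof.
move=> KN k kK; rewrite coef_vertex_poly.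
have m0 : (mdeg (@mnm0 n) < N)%N by rewrite mdeg0; lia.
rewrite -(pair_big_dep xpredT (fun I J : mindex N => (mdeg J == 0%N) && (mdeg I + mdeg J == k)%N)
  (fun I J => ((mifact R I * mifact R J)^-1 * dzs I f2 z) *: ymon R I J)).
rewrite (exchange_big_dep xpredT) //=.
rewrite (@big_only1 _ _ _ _ (BMultinom m0)) //; last first.
  move=> I nI _; apply: big1 => J /andP[/eqP/eqP]; rewrite mdeg_eq0 => /eqP I0.
  by case/negP: nI; apply/eqP/val_inj.
rewrite /ser_F2 /= mdeg0 eqxx mnm0_mizero mifact0 big_mkcond [RHS]big_mkcond.
transitivity (\sum_(J : mindex k.+1) if mdeg J == k then ((mifact R J)^-1 * dzs J f2 z) *: ymon R J (@mizero n) else 0) => //.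
rewrite (big_mindex (N := N) (F := fun J => if mdeg J == k then ((mifact R J)^-1 * dzs J f2 z) *: ymon R J (@mizero n) else 0)).
  by apply: eq_bigr => J _; rewrite addn0 mulr1.
by move=> J; case: (mdeg J =P k) => [->|]; rewrite ?eqxx // ltnSn (leq_trans kK KN).
Qed.

(** Coefficient k of S comes from total degree k + 2, whence the shift by 2 in the bound. *)
Lemma ser_S_rep K s t (i : 'I_s) : (K.+2 <= N)%N -> fps_rep K (ser_S Phi z) (vertex_poly (@Solid s t i)).
Proof.
move=> KN k kK; rewrite coef_vertex_poly /ser_S.
rewrite (@big_mindex2 _ _ N (fun I J => [&& 1 <= mdeg I, 1 <= mdeg J, 3 <= mdeg I + mdeg J
          & mdeg I + mdeg J == k + 2]%N)
  (fun I J => ((mifact R I * mifact R J)^-1 * dmix I J (potential Phi) z) *: ymon R I J)).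
  rewrite -sumrN; apply: eq_big => [x|x _]; last by rewrite /= mulrN scaleNr.
  rewrite /= -!andbA; case: (1 <= mdeg x.1)%N => //; case: (1 <= mdeg x.2)%N => //=.
  by case: ltnP => //= h3; apply/eqP/eqP; lia.
by move=> I J /and4P[h1 h2 h3 /eqP h4]; apply/and4P; split; lia.
Qed.

Lemma ser_log_rep K s t (i : 'I_t) : (K <= N)%N -> fps_rep K (ser_log Phi z) (vertex_poly (@Hollow s t i)).
Proof.
move=> KN k kK; rewrite coef_vertex_poly /ser_log.
case: eqP => [->|/eqP k0].
  rewrite big1 // => x /andP[] /=; case: (_ + _)%N => //.
rewrite /taylor.
rewrite (@big_mindex2 _ _ N (fun I J => mdeg I + mdeg J == k)%N
  (fun I J => ((mifact R I * mifact R J)^-1 * dmix I J (logdetH Phi) z) *: ymon R I J)).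
  apply: eq_big => [x|x _] //=.
  by case: eqP => [->|]; rewrite ?andbF // andbT lt0n.
by move=> I J /eqP h4; apply/and4P; split; lia.
Qed.

End Vertices.
End StarExpansion.

(** * The star product as a sum over assignments of multi-indices *)

Section StarExpand.
Variables (R : realType) (n : nat).
Local Notation C := R[i].
Local Notation mindex := (bmultinom n).
Local Notation ypoly := (mpoly (n + n) C).
Variables (Phi : 'rV[C]_n -> R) (f1 f2 : 'rV[C]_n -> C) (z : 'rV[C]_n).

Lemma prod_vertex (A : comPzRingType) s t (F : vertex s t -> A) :
  \prod_v F v = F LeftV * F RightV * (\prod_(i < s) F (Solid i)) * (\prod_(i < t) F (Hollow i)).
Proof.
rewrite (reindex (@vertex_decode s t)) /=; last first.
  exists (@vertex_code s t) => [|v _]; last exact: vertex_codeK.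
  by case=> [[]|[]].
by rewrite big_sumType /= big_sumType /= big_bool /= !mulrA.
Qed.

Definition assignment N s t := {ffun vertex s t -> mindex N * mindex N}.

Definition assignment_ok N s t (x : assignment N s t) : bool :=
  [forall v, vertex_ok v (mdeg (x v).1) (mdeg (x v).2)].

Definition assignment_term N s t (x : assignment N s t) : C :=
  (\prod_v ((mifact R (x v).1 * mifact R (x v).2)^-1 * vertex_coef Phi f1 f2 z v (x v).1 (x v).2)) *
  gauss_moment Phi z (fun i => \sum_v (x v).1 i)%N (fun i => \sum_v (x v).2 i)%N.

Lemma prod_vertex_poly N s t k :
  gauss_expect Phi z (\prod_(v : vertex s t) vertex_poly Phi f1 f2 z N v)`_k =
  \sum_(x : assignment N s t | assignment_ok x &&
      (\sum_v vertex_weight v (mdeg (x v).1) (mdeg (x v).2) == k)%N) assignment_term x.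
Proof.
rewrite /vertex_poly bigA_distr_big_dep coef_sum gauss_expect_sum big_mkcondr.
rewrite (eq_bigl (fun x : assignment N s t => assignment_ok x)); last by move=> x.
apply: eq_bigr => x _; rewrite !scaler_prod ymon_prod.
have -> : \prod_v 'X^(vertex_weight v (mdeg (x v).1) (mdeg (x v).2)) =
   'X^(\sum_v vertex_weight v (mdeg (x v).1) (mdeg (x v).2)) :> {poly ypoly}.
  by elim/big_rec2: _ => [|a m p _ ->]; [rewrite expr0 | rewrite exprD].
rewrite coefZ coefXn eq_sym; case: eqP => _.
  by rewrite mulr1 gauss_expectX.
by rewrite mulr0 /gauss_expect msupp0 big_nil.
Qed.

Lemma gauss_expectZ c p : gauss_expect Phi z (c *: p) = c * gauss_expect Phi z p.
Proof.
rewrite [in LHS](mpolyE p) scaler_sumr gauss_expect_sum [in RHS](mpolyE p) gauss_expect_sum mulr_sumr.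
apply: eq_bigr => m _; rewrite scalerA -(mjoin_split m) -ymonE !gauss_expectX.
by rewrite mulrA.
Qed.

Hypothesis hPhi : kahler_potential Phi.

Lemma star_expand k N : ((2 * k).+3 <= N)%N ->
  star Phi f1 f2 k z = \sum_(s < (2 * k).+1) \sum_(t < (2 * k).+1) (s`! * t`!)%:R^-1 *
    \sum_(x : assignment N s t | assignment_ok x &&
      (\sum_v vertex_weight v (mdeg (x v).1) (mdeg (x v).2) == 2 * k)%N) assignment_term x.
Proof.
move=> kN; rewrite /star /star_eps ser_M_exp //.
(* [vertex_poly] depends only on the kind of the vertex, so any vertex of that kind, in the smallest
   vertex set containing one, represents the series. *)
pose vL := vertex_poly Phi f1 f2 z N (@LeftV 0 0).
pose vR := vertex_poly Phi f1 f2 z N (@RightV 0 0).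
pose vS := vertex_poly Phi f1 f2 z N (@Solid 1 0 ord0).
pose vT := vertex_poly Phi f1 f2 z N (@Hollow 0 1 ord0).
have rS : fps_rep (2 * k).+1 (ser_S Phi z) vS := @ser_S_rep _ _ Phi f1 f2 z N (2 * k).+1 1 0 ord0 kN.
have kN' : ((2 * k).+1 <= N)%N by lia.
have rT : fps_rep (2 * k).+1 (ser_log Phi z) vT := @ser_log_rep _ _ Phi f1 f2 z N (2 * k).+1 0 1 ord0 kN'.
have r1 : fps_rep (2 * k).+1 (ser_F1 f1 z) vL := @ser_F1_rep _ _ Phi f1 f2 z N (2 * k).+1 0 0 kN'.
have r2 : fps_rep (2 * k).+1 (ser_F2 f2 z) vR := @ser_F2_rep _ _ Phi f1 f2 z N (2 * k).+1 0 0 kN'.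
(* A solid vertex has total degree at least 3, hence weight at least 1. *)
have S0 : ser_S Phi z 0 = 0.
  rewrite (rS 0%N) // coef_vertex_poly big1 // => x /andP[/and3P[_ _ /=]].
  by move: (_ + _)%N => a; lia.
have T0 : ser_log Phi z 0 = 0 by [].
rewrite (fps_repM (fps_repM (fps_repM r1 r2) (fps_rep_exp S0 rS)) (fps_rep_exp T0 rT)) //.
have -> : vL * vR * (\sum_(m < (2 * k).+1) (m`!%:R^-1 : C)%:A *: vS ^+ m)
     * (\sum_(m < (2 * k).+1) (m`!%:R^-1 : C)%:A *: vT ^+ m) =
   \sum_(s < (2 * k).+1) \sum_(t < (2 * k).+1) ((s`! * t`!)%:R^-1 : C)%:A *:
      \prod_(v : vertex s t) vertex_poly Phi f1 f2 z N v.
  rewrite [vL * vR * _]mulr_sumr mulr_suml; apply: eq_bigr => s _.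
  rewrite mulr_sumr; apply: eq_bigr => t _.
  have hS : \prod_(i < s) vertex_poly Phi f1 f2 z N (Solid i : vertex s t) = vS ^+ s.
    by transitivity (\prod_(i < s) vS) => //; rewrite prodr_const card_ord.
  have hT : \prod_(i < t) vertex_poly Phi f1 f2 z N (Hollow i : vertex s t) = vT ^+ t.
    by transitivity (\prod_(i < t) vT) => //; rewrite prodr_const card_ord.
  rewrite prod_vertex hS hT -[vertex_poly _ _ _ _ _ LeftV]/vL -[vertex_poly _ _ _ _ _ RightV]/vR.
  by rewrite -!scalerAr -scalerAl scalerA natrM invfM mulrC -scalerAl mul1r scalerA.
rewrite coef_sum gauss_expect_sum; apply: eq_bigr => s _.
rewrite coef_sum gauss_expect_sum; apply: eq_bigr => t _.
by rewrite -prod_vertex_poly -gauss_expectZ coefZ mulr_algl.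
Qed.


End StarExpand.

(** * Isomorphic and numbered graphs *)

Local Notation vertices G := (vertex (nsolid G) (nhollow G)).
Local Notation edges G := ('I_(nedge G)).

Section Isomorphism.

Lemma vertex_ok_kind s t s' t' (v : vertex s t) (w : vertex s' t') a b :
  same_kind v w -> vertex_ok v a b = vertex_ok w a b.
Proof. by case: v w => [||i|i] [||j|j]. Qed.

Lemma admissibleE (G : pregraph) :
  admissible G = [forall v : vertices G, vertex_ok v (indeg v) (outdeg v)].
Proof.
apply/and4P/forallP => [[h1 h2 /forallP h3 /forallP h4] [||i|i] //|h].
- exact: h3.
- exact: h4.
split; [exact: (h LeftV)|exact: (h RightV)| |].
- by apply/forallP => i; exact: (h (Solid i)).
by apply/forallP => i; exact: (h (Hollow i)).
Qed.

Section Compat.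
Variables (G G' : pregraph) (fv : vertices G -> vertices G') (fe : edges G -> edges G').
Hypotheses (bv : bijective fv) (be : bijective fe) (hc : graph_compat fv fe).

Let kv v : same_kind v (fv v).
Proof. by case/andP: hc => /forallP. Qed.
Let se e : src G' (fe e) = fv (src G e).
Proof. by case/andP: hc => _ /forallP/(_ e)/andP[/eqP]. Qed.
Let te e : tgt G' (fe e) = fv (tgt G e).
Proof. by case/andP: hc => _ /forallP/(_ e)/andP[_ /eqP]. Qed.

Lemma card_compat (P : pred (edges G)) (Q : pred (edges G')) :
  (forall e, Q (fe e) = P e) -> #|[set e | Q e]%SET| = #|[set e | P e]%SET|.
Proof.
move=> h; rewrite -(card_imset _ (bij_inj be)); apply: eq_card => e.
have [ge feK geK] := be.
apply/idP/imsetP => [|[e' he' ->]]; last by rewrite inE h; rewrite inE in he'.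
by rewrite inE => he; exists (ge e); rewrite ?geK // inE -h geK.
Qed.

Lemma indeg_compat v : indeg (fv v) = indeg v.
Proof. by apply: card_compat => e; rewrite te (inj_eq (bij_inj bv)). Qed.

Lemma outdeg_compat v : outdeg (fv v) = outdeg v.
Proof. by apply: card_compat => e; rewrite se (inj_eq (bij_inj bv)). Qed.

Lemma admissible_compat : admissible G' = admissible G.
Proof.
have [gv fvK gvK] := bv.
rewrite !admissibleE; apply/forallP/forallP => h v.
  have := h (fv v); rewrite indeg_compat outdeg_compat.
  by rewrite (vertex_ok_kind _ _ (kv v)).
rewrite -(gvK v) indeg_compat outdeg_compat -(vertex_ok_kind _ _ (kv (gv v))).
exact: h.
Qed.

Lemma dims_compat : [/\ nsolid G = nsolid G', nhollow G = nhollow G' & nedge G = nedge G'].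
Proof.
have ce := bij_eq_card be; rewrite !card_ord in ce.
have [gv fvK gvK] := bv.
(* The predicate is quantified over all sizes because the two graphs have different vertex types; it
   is then used for solid and for hollow vertices. *)
have cv (P : forall s t, pred (vertex s t)) :
    (forall s t s' t' (v : vertex s t) (w : vertex s' t'), same_kind v w -> P _ _ v = P _ _ w) ->
    #|[set v | P (nsolid G) (nhollow G) v]%SET| = #|[set v | P (nsolid G') (nhollow G') v]%SET|.
  move=> hP; rewrite -(card_imset _ (bij_inj bv)); apply: eq_card => v.
  apply/imsetP/idP => [[w hw ->]|]; first by rewrite inE -(hP _ _ _ _ _ _ (kv w)); rewrite inE in hw.
  by rewrite inE => hv; exists (gv v); rewrite ?gvK // inE (hP _ _ _ _ _ _ (kv (gv v))) gvK.
have cs s t : #|[set v : vertex s t | if v is Solid _ then true else false]%SET| = s.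
  rewrite -[RHS]card_ord -(card_imset 'I_s (_ : injective (@Solid s t))); last by move=> i j [].
  apply: eq_card => -[||i|i]; rewrite inE; apply/esym/imsetP.
  - by case. - by case. - by exists i. by case.
have ch s t : #|[set v : vertex s t | if v is Hollow _ then true else false]%SET| = t.
  rewrite -[RHS]card_ord -(card_imset 'I_t (_ : injective (@Hollow s t))); last by move=> i j [].
  apply: eq_card => -[||i|i]; rewrite inE; apply/esym/imsetP.
  - by case. - by case. - by case. by exists i.
split=> //.
  rewrite -(cs (nsolid G) (nhollow G)) -[RHS](cs (nsolid G') (nhollow G')).
  apply: (cv (fun s t (v : vertex s t) => if v is Solid _ then true else false)).
  by move=> s t s' t' [||i|i] [||j|j].
rewrite -(ch (nsolid G) (nhollow G)) -[RHS](ch (nsolid G') (nhollow G')).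
apply: (cv (fun s t (v : vertex s t) => if v is Hollow _ then true else false)).
by move=> s t s' t' [||i|i] [||j|j].
Qed.

Lemma partition_function_compat (R : realType) n (Phi : 'rV[R[i]]_n -> R) f1 f2 z :
  partition_function Phi G f1 f2 z = partition_function Phi G' f1 f2 z.
Proof.
have [ge feK geK] := be.
pose up (k : {ffun edges G -> 'I_n}) : {ffun edges G' -> 'I_n} := [ffun e => k (ge e)].
have bup : bijective up.
  exists (fun k : {ffun edges G' -> 'I_n} => [ffun e => k (fe e)]) => k.
    by apply/ffunP => e; rewrite !ffunE feK.
  by apply/ffunP => e; rewrite !ffunE geK.
have upE k e : up k (fe e) = k e by rewrite ffunE feK.
rewrite /partition_function [RHS](reindex up) /=; last exact: onW_bij.
apply: eq_bigr => k _; rewrite [RHS](reindex up) /=; last exact: onW_bij.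
apply: eq_bigr => l _; congr (_ * _).
  rewrite [RHS](reindex fe) /=; last exact: onW_bij.
  by apply: eq_bigr => e _; rewrite !upE.
rewrite [RHS](reindex fv) /=; last exact: onW_bij.
apply: eq_bigr => v _.
have hin : in_index (up k) (fv v) = in_index k v.
  by apply: funext => i; apply: card_compat => e; rewrite te upE (inj_eq (bij_inj bv)).
have hout : out_index (up l) (fv v) = out_index l v.
  by apply: funext => i; apply: card_compat => e; rewrite se upE (inj_eq (bij_inj bv)).
have := kv v; rewrite /vertex_factor hin hout.
by case: v {hin hout} (fv v) => [||i|i] [||j|j].
Qed.

End Compat.

(** [graph_iso] without proofs of admissibility, so that it applies to every term of a sum over
    numbered graphs. *)
Definition pregraph_iso (G G' : pregraph) : bool :=
  `[< exists (fv : vertices G -> vertices G') (fe : edges G -> edges G'),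
        [/\ bijective fv, bijective fe & graph_compat fv fe] >].

End Isomorphism.

(** * Renumberings of vertices and edges *)

Section Relabel.
Variables s t : nat.

Definition kind_perm (p : 'S_s * 'S_t) (v : vertex s t) : vertex s t :=
  match v with
  | LeftV => LeftV | RightV => RightV
  | Solid i => Solid (p.1 i) | Hollow i => Hollow (p.2 i)
  end.

Lemma kind_perm_inj p : injective (kind_perm p).
Proof. by move=> [||i|i] [||j|j] //= [] /perm_inj ->. Qed.

Lemma card_kind_perms :
  #|[set q : {perm vertex s t} | [forall v, same_kind v (q v)]]%SET| = (s`! * t`!)%N.
Proof.
pose F p := perm (@kind_perm_inj p).
have Finj : injective F.
  move=> [a b] [a' b'] /permP h; congr (_, _); apply/permP => i.
    by have := h (Solid i); rewrite !permE /= => -[].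
  by have := h (Hollow i); rewrite !permE /= => -[].
have -> : (s`! * t`!)%N = #|[set: 'S_s * 'S_t]%SET|.
  by rewrite cardsT card_prod !card_Sn.
rewrite -(card_imset _ Finj); apply: eq_card => q; rewrite inE.
apply/forallP/imsetP => [h|[p _ ->] v]; last by rewrite permE; case: v.
(* The default branch is never taken, as [q] preserves the kinds. *)
pose gs i := if q (Solid i) is Solid j then j else i.
pose gt i := if q (Hollow i) is Hollow j then j else i.
have gsE i : q (Solid i) = Solid (gs i).
  by rewrite /gs; have := h (Solid i); case: (q (Solid i)).
have gtE i : q (Hollow i) = Hollow (gt i).
  by rewrite /gt; have := h (Hollow i); case: (q (Hollow i)).
have is_ : injective gs by move=> i j e; have := gsE i; rewrite e -gsE => /perm_inj[].
have it : injective gt by move=> i j e; have := gtE i; rewrite e -gtE => /perm_inj[].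
exists (perm is_, perm it) => //; apply/permP => v; rewrite permE.
case: v => [||i|i] /=; rewrite ?permE //.
  by have := h LeftV; case: (q LeftV).
by have := h RightV; case: (q RightV).
Qed.

Variable e : nat.
Local Notation ends := {ffun 'I_e -> vertex s t}.

Definition compat_perms (G G' : ends * ends) : {set {perm vertex s t} * {perm 'I_e}} :=
  [set p : {perm vertex s t} * {perm 'I_e} |
    graph_compat (G := Pregraph G.1 G.2) (G' := Pregraph G'.1 G'.2) p.1 p.2]%SET.

(** Composing automorphisms of G with one isomorphism [g] gives all of them: the set is the right
    coset of Aut by [g]. *)
Lemma card_compat_perms (G G' : ends * ends) : compat_perms G G' != finset.set0 ->
  #|compat_perms G G'| = #|graph_Aut (Pregraph G.1 G.2)|.
Proof.
case/finset.set0Pn => g hg; rewrite inE in hg.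
case/andP: hg => /forallP /= kg /forallP /= eg.
rewrite -[RHS](card_rcoset _ g); apply: eq_card => q.
rewrite mem_rcoset !inE /graph_compat /=; congr (_ && _).
  apply: eq_forallb => v; rewrite permM.
  have := kg (g.1^-1 (q.1 v))%g; rewrite permKV.
  have kk (a b c : vertex s t) : same_kind a b -> same_kind c b = same_kind c a.
    by case: a b c => [||?|?] [||?|?] [||?|?].
  exact: kk.
apply: eq_forallb => x; rewrite !permM.
have := eg (g.2^-1 (q.2 x))%g; rewrite permKV => /andP[/eqP -> /eqP ->].
by rewrite !(can2_eq (permK _) (permKV _)).
Qed.

Lemma compat_perms_iso (G G' : ends * ends) :
  (compat_perms G G' != finset.set0) = pregraph_iso (Pregraph G.1 G.2) (Pregraph G'.1 G'.2).
Proof.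
apply/finset.set0Pn/asboolP => [[p]|[fv [fe [bv be hc]]]].
  by rewrite inE => hp; exists p.1, p.2; split=> //; apply: injF_bij; apply: perm_inj.
exists (perm (bij_inj bv), perm (bij_inj be)); rewrite inE.
rewrite (_ : graph_compat _ _ = graph_compat fv fe) // /graph_compat /=; congr (_ && _).
  by apply: eq_forallb => v; rewrite permE.
by apply: eq_forallb => x; rewrite !permE.
Qed.

(* Each of the s! t! e! renumberings of [G] is an isomorphism onto exactly one
   numbered graph, and the isomorphisms onto a given one form a coset of Aut. *)
Lemma card_iso (G : ends * ends) :
  (#|[set G' : ends * ends | pregraph_iso (Pregraph G.1 G.2) (Pregraph G'.1 G'.2)]%SET|
    * #|graph_Aut (Pregraph G.1 G.2)| = s`! * t`! * e`!)%N.
Proof.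
have -> : (s`! * t`! * e`!)%N =
    #|finset.setX [set q : {perm vertex s t} | [forall v, same_kind v (q v)]]%SET [set: 'S_e]%SET|.
  by rewrite cardsX card_kind_perms cardsT card_Sn.
rewrite -sum_nat_const -[RHS]sum1_card.
(* The pairs of a numbered graph G' and an isomorphism onto it are counted in two ways. *)
transitivity (\sum_(G' : ends * ends) #|compat_perms G G'|)%N.
  rewrite big_mkcond; apply: eq_bigr => G' _; rewrite inE -compat_perms_iso.
  by case: ifP => [/card_compat_perms -> //|/negbFE/eqP ->]; rewrite cards0.
rewrite (eq_bigr (fun G' => \sum_(p in compat_perms G G') 1)%N); last by move=> G' _; rewrite sum1_card.
rewrite (exchange_big_dep (mem (finset.setX [set q : {perm vertex s t} | [forall v, same_kind v (q v)]]%SET [set: 'S_e]%SET))) /=; last first.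
  by move=> G' p _; rewrite !inE andbT => /andP[].
apply: eq_bigr => -[q r]; rewrite !inE andbT /= => hq.
(* The ends of the edges after renumbering by (q, r), which determine the only possible G'. *)
pose rel (a : ends) : ends := [ffun x => q (a (r^-1 x)%g)].
rewrite (big_pred1 (rel G.1, rel G.2)) // => G'; rewrite inE /graph_compat /= hq /=.
apply/forallP/eqP => [h|-> x].
  rewrite [G']surjective_pairing; congr (_, _); apply/ffunP => x; rewrite ffunE.
    by have /andP[/eqP <- _] := h (r^-1 x)%g; rewrite permKV.
  by have /andP[_ /eqP <-] := h (r^-1 x)%g; rewrite permKV.
by rewrite !ffunE permK !eqxx.
Qed.

End Relabel.

(** * From isomorphism classes to numbered graphs *)

Section GraphSum.
Variable K : numFieldType.

Notation ends s t e := {ffun 'I_e -> vertex s t}.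

Definition pregraph_of s t e (P : ends s t e * ends s t e) : pregraph := Pregraph P.1 P.2.

Definition has_dims (G : pregraph) s t e : bool :=
  [&& nsolid G == s, nhollow G == t & nedge G == e].

Lemma pregraph_iso_dims G G' : pregraph_iso G G' ->
  has_dims G (nsolid G') (nhollow G') (nedge G').
Proof.
move=> /asboolP[fv [fe [bv be hc]]].
by have [e1 e2 e3] := dims_compat bv be hc; rewrite /has_dims e1 e2 e3 !eqxx.
Qed.

Lemma pregraph_iso_admissible G G' : pregraph_iso G G' -> admissible G' = admissible G.
Proof. by move=> /asboolP[fv [fe [bv be hc]]]; exact: admissible_compat bv be hc. Qed.

Lemma card_Aut_gt0 G : (0 < #|graph_Aut G|)%N.
Proof.
apply/card_gt0P; exists (1, 1)%g; rewrite inE; apply/andP; split; apply/forallP => x.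
  by rewrite perm1; case: x.
by rewrite !perm1 !eqxx.
Qed.

Lemma card_iso_class (G : graph) s t e :
  (\sum_(P : ends s t e * ends s t e | admissible (pregraph_of P)) pregraph_iso G (pregraph_of P))%N%:R
   = (has_dims G s t e)%:R * (s`! * t`! * e`!)%:R / #|graph_Aut G|%:R :> K.
Proof.
case: (boolP (has_dims G s t e)) => hd; last first.
  rewrite mul0r mul0r big1 // => P _; case: (boolP (pregraph_iso _ _)) => // /pregraph_iso_dims h.
  by rewrite h in hd.
(* The graph is taken apart so that its sizes, on which the types of [a] and [b] depend, become
   variables that [subst] can identify. *)
case: G hd => -[s' t' e' a b] adm; rewrite /has_dims /= => /and3P[/eqP e1 /eqP e2 /eqP e3].
subst s' t' e'.
have := card_iso (a, b); set iso := [set _ | _]%SET => h.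
have A0 : (#|graph_Aut (Pregraph a b)|)%:R != 0 :> K.
  by rewrite pnatr_eq0 -lt0n card_Aut_gt0.
apply: (mulIf A0); rewrite divfK // mul1r -natrM -h; congr (_ * _)%:R.
rewrite -sum1_card big_mkcond [RHS]big_mkcond; apply: eq_bigr => P _.
rewrite inE /=; case: (boolP (pregraph_iso _ _)) => // [/pregraph_iso_admissible ->|].
  by rewrite adm.
by case: ifP.
Qed.

(** The condition chi = k fixes the number of edges as s + k, and 3 s + t <= 2 (s + k) from
    [admissible_bound] gives s + t <= 2 k, hence the ranges of s and t. *)
Lemma graph_sum (F : pregraph -> K) k :
  (forall G G', pregraph_iso G G' -> F G = F G') ->
  \sum_(G \in [set G : graph_class | chi (repr G) = k%:Z]) (#|graph_Aut (repr G)|%:R)^-1 * F (repr G)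
  = \sum_(s < (2 * k).+1) \sum_(t < (2 * k).+1) (s`! * t`! * (s + k)`!)%:R^-1 *
      \sum_(P : ends s t (s + k) * ends s t (s + k) | admissible (pregraph_of P)) F (pregraph_of P).
Proof.
move=> hF; have fin := finite_chi k.
rewrite (fsbig_finite _ _ fin) /=; set S := fset_set _.
have memS G : (G \in S) = (chi (repr G) == k%:Z).
  by rewrite /S in_fset_set //; apply/idP/eqP => [/set_mem|h]; last exact: mem_set.
have inner s t : \sum_(P : ends s t (s + k) * ends s t (s + k) | admissible (pregraph_of P)) F (pregraph_of P)
   = \sum_(G <- S) F (repr G) * ((has_dims (repr G) s t (s + k))%:R * (s`! * t`! * (s + k)`!)%:R / #|graph_Aut (repr G)|%:R).
  under [RHS]eq_bigr => G _ do rewrite -card_iso_class natr_sum mulr_sumr.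
  rewrite [RHS]exchange_big /=; apply: eq_bigr => P adm.
  (* The class of [P] is the only one that contributes to the summand of [P]. *)
  pose G0 : graph_class := \pi_(graph_class) (Graph adm).
  have iso0 : pregraph_iso (repr G0) (pregraph_of P).
    have : (repr G0 = Graph adm %[mod graph_class])%qT by rewrite reprK.
    by move/eqmodP.
  have G0S : G0 \in S.
    have /and3P[/eqP h1 _ /eqP h3] := pregraph_iso_dims iso0.
    rewrite memS /chi h1 h3 /=; apply/eqP; lia.
  rewrite (bigD1_seq G0) ?fset_uniq //= iso0 mulr1 (hF _ _ iso0) big1 ?addr0 // => G nG.
  case: (boolP (pregraph_iso (repr G) (pregraph_of P))) => h; last by rewrite mulr0.
  case/eqP: nG; rewrite -[G]reprK /G0; apply/eqmodP.
  exact: h.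
under [RHS]eq_bigr => s _ do under eq_bigr => t _ do rewrite inner mulr_sumr.
under [RHS]eq_bigr => s _ do rewrite exchange_big /=.
rewrite [RHS]exchange_big /= big_seq [RHS]big_seq; apply: eq_bigr => G.
rewrite memS => /eqP hk.
have [b1 b2] : (3 * nsolid (repr G) + nhollow (repr G) <= 2 * nedge (repr G))%N /\
   (nsolid (repr G) <= nedge (repr G))%N.
  by apply: admissible_bound; case: (repr G).
have he : nedge (repr G) = (nsolid (repr G) + k)%N by move: hk b2; rewrite /chi; move: (nsolid _) (nedge _) => a b /=; clear; lia.
have hs : (nsolid (repr G) < (2 * k).+1)%N by lia.
have ht : (nhollow (repr G) < (2 * k).+1)%N by lia.
rewrite (@big_only1 _ _ _ _ (Ordinal hs)) //; last first.
  move=> s ns _; apply: big1 => t _; rewrite /has_dims.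
  case: (nsolid (repr G) =P s) => [e1|_]; last by rewrite /= !mul0r !mulr0.
  by case/eqP: ns; apply: val_inj.
rewrite (@big_only1 _ _ _ _ (Ordinal ht)) //; last first.
  move=> t nt _; rewrite /has_dims.
  case: (nhollow (repr G) =P t) => [e1|_]; last by rewrite /= andbF !mul0r !mulr0.
  by case/eqP: nt; apply: val_inj.
rewrite /= (_ : has_dims _ _ _ _ = true); last by rewrite /has_dims he !eqxx.
move: (#|graph_Aut _|%:R^-1) (F _) => A y.
set D := (_ * _ * (_)`!)%N%:R; have D0 : D != 0.
  by rewrite /D pnatr_eq0 -lt0n !muln_gt0 !fact_gt0.
by rewrite mul1r [y * _]mulrC -[D * A * y]mulrA mulKf.
Qed.

End GraphSum.

(** * The graph expansion *)

Section Final.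
Variables (R : realType) (n : nat).
Local Notation C := R[i].
Local Notation mindex := (bmultinom n).

(** In [dmix_gauss_ffun] the words [k] and [l] have the same length, so no word [k] of content I
    exists when |I| differs from |J|. [card_occ] serves only to produce one word [l] of content
    J. *)
Lemma dmix_exp_form_eq0 (h : 'M[C]_n) (I J : 'I_n -> nat) :
  (\sum_i I i != \sum_i J i)%N -> dmix I J (exp_form h) 0 = 0.
Proof.
move=> IJ; have hc := card_occ (erefl (\sum_i J i)%N).
have : (0 < \sum_(l : {ffun 'I_(\sum_i J i) -> 'I_n}) [forall t, occ l t == J t])%N.
  rewrite lt0n; apply/eqP => c0; move: hc; rewrite c0 mul0n => e0.
  by have := fact_gt0 (\sum_i J i)%N; rewrite -e0.
rewrite lt0n sum_nat_eq0 => /forallPn[l]; rewrite /= eqb0 negbK => /forallP hl.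
rewrite (@dmix_gauss_ffun _ _ _ _ _ _ l); last by move=> j; rewrite -occE (eqP (hl j)).
rewrite [X in _ * X]big1 ?mulr0 // => k /forallP hk; case/eqP: IJ.
rewrite -[RHS](sum_occ k); apply: eq_bigr => i _.
by rewrite occE (eqP (hk i)).
Qed.

Variables (Phi : 'rV[C]_n -> R) (f1 f2 : 'rV[C]_n -> C) (z : 'rV[C]_n).

(** The count of half-edges, with the 2 per solid vertex moved to the left. The truncated
    subtraction in [vertex_weight] is exact because a solid vertex has degree at least 3. *)
Lemma sum_vertex_weight N s t (x : assignment n N s t) : assignment_ok x ->
  (\sum_v vertex_weight v (mdeg (x v).1) (mdeg (x v).2) + 2 * s =
   \sum_v mdeg (x v).1 + \sum_v mdeg (x v).2)%N.
Proof.
move=> /forallP hx; rewrite -big_split /= !big_vertex.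
have -> : (\sum_(i < s) (mdeg (x (Solid i)).1 + mdeg (x (Solid i)).2) =
  \sum_(i < s) vertex_weight (Solid i : vertex s t) (mdeg (x (Solid i)).1) (mdeg (x (Solid i)).2) + 2 * s)%N.
  rewrite mulnC -[X in (_ = _ + X * _)%N]card_ord -sum_nat_const -big_split /=; apply: eq_bigr => i _.
  by have /and3P[_ _ h3] := hx (Solid i); rewrite subnK // (ltn_trans _ h3).
by rewrite /=; lia.
Qed.

(** Sources, targets and both index words determine exactly one assignment. Admissibility and the
    vertex factors depend on nothing else, so the edge factors can be summed over each fibre by
    [wick_sum]. *)
Lemma sum_partition_function N s t e : (e < N)%N ->
  \sum_(P : {ffun 'I_e -> vertex s t} * {ffun 'I_e -> vertex s t} | admissible (pregraph_of P))
     partition_function Phi (pregraph_of P) f1 f2 z =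
  \sum_(x : assignment n N s t | assignment_ok x)
    (\sum_v mdeg (x v).2 == e)%N%:R * e`!%:R * assignment_term Phi f1 f2 z x.
Proof.
move=> eN.
pose c (x : assignment n N s t) v i := (x v).1 i.
pose d (x : assignment n N s t) v i := (x v).2 i.
pose h := hinv Phi z.
pose coef (x : assignment n N s t) := \prod_v vertex_coef Phi f1 f2 z v (x v).1 (x v).2.
transitivity (\sum_(x : assignment n N s t | assignment_ok x) coef x *
  \sum_(a : {ffun 'I_e -> vertex s t}) \sum_(b : {ffun 'I_e -> vertex s t})
    \sum_(k : {ffun 'I_e -> 'I_n}) \sum_(l : {ffun 'I_e -> 'I_n})
      (has_occ2 b k (c x) && has_occ2 a l (d x))%:R * \prod_a h (k a) (l a)); last first.
  apply: eq_bigr => x _; rewrite wick_sum /assignment_term.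
  have -> : (\sum_v \sum_i d x v i)%N = (\sum_v mdeg (x v).2)%N.
    by apply: eq_bigr => v _; rewrite mdegE.
  rewrite big_split /= -/(coef x).
  have -> : \prod_v (mifact R (x v).1 * mifact R (x v).2)^-1 = ((fact2 (c x))%:R * (fact2 (d x))%:R)^-1.
    by rewrite prodfV big_split /= /fact2 !natr_prod.
  rewrite -[gauss_moment _ _ _ _]/(dmix _ _ (exp_form h) 0).
  move: (dmix _ _ _ _) (coef x) (_^-1) (_%:R) (_%:R) => g y w u v.
  by rewrite mulrCA -!mulrA; congr (_ * (_ * _)); rewrite mulrCA mulrA.
(* A vertex sees at most e edge-ends of each direction, so e < N makes its multi-indices fit into
   [mindex N]. *)
have bN (v : {ffun 'I_e -> vertex s t}) (k : {ffun 'I_e -> 'I_n}) y :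
    (mdeg (Multinom [tuple occ2 v k y i | i < n]) < N)%N.
  rewrite mdegE (eq_bigr (occ2 v k y)); last by move=> i _; rewrite /fun_of_multinom tnth_mktuple.
  apply: leq_ltn_trans eN; rewrite -[X in (_ <= X)%N](sum_occ k); apply: leq_sum => i _.
  by rewrite -(sum_occ2 v) (bigD1 y) //= leq_addr.
have one (a b : {ffun 'I_e -> vertex s t}) (k l : {ffun 'I_e -> 'I_n}) : exists x : assignment n N s t, forall x',
    (has_occ2 b k (c x') && has_occ2 a l (d x')) = (x' == x).
  exists [ffun v => (BMultinom (bN b k v), BMultinom (bN a l v))] => x'.
  apply/andP/eqP => [[/forallP h1 /forallP h2]|->].
    apply/ffunP => v; rewrite ffunE [x' v]surjective_pairing; congr (_, _); apply: val_inj;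
      apply/mnmP => i /=; rewrite [RHS]/fun_of_multinom tnth_mktuple.
      by have /forallP/(_ i)/eqP := h1 v.
    by have /forallP/(_ i)/eqP := h2 v.
  by split; apply/forallP => v; apply/forallP => i; rewrite /c /d ffunE /= /fun_of_multinom tnth_mktuple.
under [RHS]eq_bigr => x _ do rewrite mulr_sumr.
rewrite [RHS]exchange_big /= [LHS]big_mkcond /=.
transitivity (\sum_(a : {ffun 'I_e -> vertex s t}) \sum_(b : {ffun 'I_e -> vertex s t})
   (if admissible (pregraph_of (a, b)) then partition_function Phi (pregraph_of (a, b)) f1 f2 z else 0)).
  by rewrite pair_bigA; apply: eq_bigr => -[a b] _.
apply: eq_bigr => a _.
under [RHS]eq_bigr => x _ do rewrite mulr_sumr.
rewrite [RHS]exchange_big /=; apply: eq_bigr => b _.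
under [RHS]eq_bigr => x _ do rewrite mulr_sumr.
rewrite [RHS]exchange_big /= /partition_function.
transitivity (\sum_(k : {ffun 'I_e -> 'I_n}) \sum_(l : {ffun 'I_e -> 'I_n})
  if admissible (pregraph_of (a, b)) then (\prod_(e0 < e) h (k e0) (l e0)) *
    (\prod_(v : vertex s t) @vertex_factor R n Phi (pregraph_of (a, b)) f1 f2 k l v z) else 0).
  case: ifP => // _; rewrite big1 // => k _; exact: big1.
apply: eq_bigr => k _.
under [RHS]eq_bigr => x _ do rewrite mulr_sumr.
rewrite [RHS]exchange_big /=; apply: eq_bigr => l _.
have [x hx] := one a b k l.
rewrite [RHS]big_mkcond (@big_only1 _ _ _ _ x) //; last first.
  by move=> x' nx _; rewrite hx (negbTE nx) mul0r mulr0; case: ifP.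
have := hx x; rewrite eqxx => /andP[/forallP h1 /forallP h2].
rewrite hx eqxx mul1r.
have ein v : @in_index n (pregraph_of (a, b)) k v = (x v).1.
  by apply: funext => i; rewrite /in_index -occ2E; have /forallP/(_ i)/eqP := h1 v.
have eout v : @out_index n (pregraph_of (a, b)) l v = (x v).2.
  by apply: funext => i; rewrite /out_index -occ2E; have /forallP/(_ i)/eqP := h2 v.
have deg (f : {ffun 'I_e -> vertex s t}) (m : {ffun 'I_e -> 'I_n}) v :
    #|[set e0 | f e0 == v]%SET| = (\sum_i occ2 f m v i)%N.
  rewrite -occE /occ2 exchange_big /=; apply: eq_bigr => e0 _.
  by rewrite (@big_only1 _ _ _ _ (m e0)) ?eqxx ?andbT // => i im _; rewrite [m e0 == i]eq_sym (negbTE im) andbF.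
have ideg v : @indeg (pregraph_of (a, b)) v = mdeg (x v).1.
  rewrite /indeg (deg b k) mdegE; apply: eq_bigr => i _.
  by have /forallP/(_ i)/eqP := h1 v.
have odeg v : @outdeg (pregraph_of (a, b)) v = mdeg (x v).2.
  rewrite /outdeg (deg a l) mdegE; apply: eq_bigr => i _.
  by have /forallP/(_ i)/eqP := h2 v.
have -> : admissible (pregraph_of (a, b)) = assignment_ok x.
  by rewrite admissibleE; apply: eq_forallb => v; rewrite ideg odeg.
case: ifP => // _; rewrite mulrC; congr (_ * _); apply: eq_bigr => v _.
rewrite /vertex_factor ein eout.
by case: v.
Qed.

Lemma star_eq_graph_sum (hPhi : kahler_potential Phi) k :
  star Phi f1 f2 k z = \sum_(G \in [set G : graph_class | chi (repr G) = k%:Z])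
       (#|graph_Aut (repr G)|%:R)^-1 * partition_function Phi (repr G) f1 f2 z.
Proof.
rewrite (graph_sum (F := fun G => partition_function Phi G f1 f2 z)); last first.
  move=> G G' /asboolP[fv [fe [bv be hc]]]; exact: (partition_function_compat bv be hc).
(* One truncation degree for both sides: the star product requires 2 k + 3, and the graphs more than
   the number of edges s + k <= 3 k. *)
have kN : ((2 * k).+3 <= 4 * k + 4)%N by lia.
rewrite (star_expand f1 f2 z hPhi kN); apply: eq_bigr => s _; apply: eq_bigr => t _.
have eN : (s + k < 4 * k + 4)%N by have := ltn_ord s; lia.
rewrite (sum_partition_function _ _ eN).
rewrite mulr_sumr mulr_sumr big_mkcondr; apply: eq_bigr => x ok.
have hw := sum_vertex_weight ok.
(* The two conditions on [x], e = s + k and total weight 2 k, are equivalent only when the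
   holomorphic and antiholomorphic degrees agree; otherwise the moment vanishes. *)
case: (eqVneq (assignment_term Phi f1 f2 z x) 0) => [->|nz].
  by rewrite !mulr0; case: ifP.
have hd : (\sum_v mdeg (x v).1 = \sum_v mdeg (x v).2)%N.
  apply/eqP; apply: contraR nz => ne; rewrite /assignment_term.
  rewrite [gauss_moment _ _ _ _](@dmix_exp_form_eq0 (hinv Phi z)) ?mulr0 //.
  rewrite exchange_big [X in _ != X]exchange_big /=.
  by under eq_bigr do rewrite -mdegE; under [X in _ != X]eq_bigr do rewrite -mdegE.
have -> : (\sum_v mdeg (x v).2 == s + k)%N =
   (\sum_v vertex_weight v (mdeg (x v).1) (mdeg (x v).2) == 2 * k)%N.
  have aux W A B s' : (W + 2 * s' = A + B -> A = B -> (B == s' + k) = (W == 2 * k))%N.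
    by move=> h1 h2; apply/eqP/eqP; lia.
  exact: aux hw hd.
case: ifP => _; last by rewrite !mul0r mulr0.
(* The (s + k)! from the numbering of the edges cancels the e! from Wick's theorem. *)
rewrite mul1r [in RHS]natrM invfM -[RHS]mulrA mulKf // pnatr_eq0 -lt0n fact_gt0 //.
Qed.

End Final.

Theorem theorem3p5 (R : realType) (n : nat) (Phi : 'rV[R[i]]_n -> R)
    (hPhi : kahler_potential Phi)
    (f1 f2 : 'rV[R[i]]_n -> R[i]) (hf1 : smooth f1) (hf2 : smooth f2)
    (k : nat) (z : 'rV[R[i]]_n) :
  star Phi f1 f2 k z =
    \sum_(G \in [set G : graph_class | chi (repr G) = k%:Z])
       (#|graph_Aut (repr G)|%:R)^-1 * partition_function Phi (repr G) f1 f2 z.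
Proof. exact: star_eq_graph_sum. Qed.
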